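(* Let $w:\mathbb{N}\to\mathbb{Z}_{\ge 0}$ be an additive arithmetic function (i.e. $w(mn)=w(m)+w(n)$ whenever $\gcd(m,n)=1$) with non-negative integer values such that $w(q)=1$ for every prime $q$. Let $E$ be the set of natural numbers that are not of the form $n+w(n)$ with $n\in\mathbb{N}$, and for $N\ge 1$ let $\Xi(N)=|[1,N]\cap E|$. Then \[ \Xi(N)\gg \frac{N}{\log\log N}, \] i.e. there is a constant $c>0$ such that $\Xi(N)\ge cN/\log\log N$ for all sufficiently large $N$.
   Context: Examples of admissible $w$ include $\omega(n)$ (number of distinct prime factors) and $\Omega(n)$ (number of prime factors counted with multiplicity). *)

(* Defs.v *)
From HB Require Import structures.
From mathcomp Require Import all_boot all_order all_algebra finmap.
From mathcomp Require Import all_classical all_reals all_analysis.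
Set Implicit Arguments.
Unset Strict Implicit.
Unset Printing Implicit Defensive.
Import Order.TTheory GRing.Theory Num.Theory.
Local Open Scope classical_set_scope.

(* Arithmetic functions have the positive integers as domain; the value at 0
   of a function on [nat] is never constrained nor used. *)
Definition additive_arith (w : nat -> nat) : Prop :=
  forall m n : nat, (0 < m)%N -> (0 < n)%N -> coprime m n ->
    w (m * n)%N = (w m + w n)%N.

Definition exceptional (w : nat -> nat) : set nat :=
  [set m | (0 < m)%N /\ ~ (exists2 n : nat, (0 < n)%N & m = (n + w n)%N)].

Definition Xi (w : nat -> nat) (N : nat) : nat :=
  #|` fset_set ([set m : nat | (1 <= m <= N)%N] `&` exceptional w)|%fset.

(* Main.v *)
(** Put [z = e(a/q)] with [q] a prime of size about [sqrt (ln (ln N))] and [a] a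
    large constant.  If [n + w n] missed few integers up to [N], the exponential
    sum [S] of [z ^ (n + w n)] over [n <= N] would be nearly the geometric sum of
    the [z ^ m]; precisely [|S| <= q + 2 Xi(N)].

    On the other hand [|S| >= N / q^2].  Write [f n = z ^ w n] and let [f'] be [f]
    with the [q]-part of [n] ignored.  The multiplicative function [f'] is the
    convolution [1 * h] with [h(p) = z - 1 = O(1/q)], so that [sum |h(d)|] over
    [d <= N] saves any fixed power of [q]; since [z ^ d <> 1] whenever [h d <> 0],
    the sum of [f' n * z ^ n] is at most [q * sum |h(d)|] and is negligible.  What
    is left are the [n] divisible by [q], where [z ^ n = 1] and
    [f n - f' n = (z - 1) f(n / q)] apart from the [n] divisible by [q^2].  As
    [|z - 1|] is about [1 / sqrt (ln (ln N))], Turan's inequality shows that [f] is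
    nearly constant on squarefree numbers, which have density above one half, so
    the sum of [f] up to [N / q] has size at least a constant times [N / q]. *)

Require Import Defs.
From HB Require Import structures.
From mathcomp Require Import all_boot all_order all_algebra.
From mathcomp Require Import all_classical all_reals all_analysis.
From mathcomp Require Import finmap complex zify ring lra.
Import Order.TTheory GRing.Theory Num.Theory.
Import numFieldNormedType.Exports.
Local Open Scope classical_set_scope.
Local Open Scope ring_scope.

Set Implicit Arguments.
Unset Strict Implicit.
Unset Printing Implicit Defensive.

(** * Chebyshev bounds *)

Section Chebyshev.
Local Open Scope nat_scope.
Implicit Types (a b i j k m n p : nat).

Lemma Euclid_dvd_fact p n : prime p -> (p %| n`!) = (p <= n).
Proof.
move=> p_pr; apply/idP/idP => [|p_le]; last by rewrite dvdn_fact// prime_gt0.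
elim: n => [|n IHn]; first by rewrite fact0 Euclid_dvd1.
rewrite factS Euclid_dvdM// => /orP[/dvdn_leq->//|/IHn/leqW//].
Qed.

Lemma prod_primes_dvd a b n :
    (forall p, prime p -> a <= p < b -> p %| n) ->
  \prod_(a <= p < b | prime p) p %| n.
Proof.
elim: b => [|b IHb] n_dvd; first by rewrite big_geq.
have [a_le|b_lt] := leqP a b; last by rewrite big_geq.
rewrite big_mkcond big_nat_recr//= -big_mkcond/=.
have prod_dvd : \prod_(a <= p < b | prime p) p %| n.
  by apply: IHb => p p_pr /andP[a_p p_b]; rewrite n_dvd// a_p ltnW.
case: ifP => [b_pr|_]; last by rewrite muln1.
rewrite Gauss_dvd ?prod_dvd ?n_dvd ?a_le ?leqnn// coprime_sym big_nat_cond.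
elim/big_rec: _ => [|p x /andP[/andP[_ p_b] p_pr] b_x]; first exact: coprimen1.
by rewrite coprimeMr b_x prime_coprime// dvdn_prime2// gtn_eqF.
Qed.

Lemma bin_doubleS_le m : 'C(m.*2.+1, m) <= 4 ^ m.
Proof.
have bin_sym : 'C(m.*2.+1, m.+1) = 'C(m.*2.+1, m).
  by rewrite -bin_sub; [congr 'C(_, _)|]; lia.
have m_lt : m < m.*2.+2 by lia.
have mS_lt : m.+1 < m.*2.+2 by lia.
have : 'C(m.*2.+1, m.+1) + 'C(m.*2.+1, m) <= (1 + 1) ^ m.*2.+1.
  rewrite expnDn (bigD1 (Ordinal mS_lt))// (bigD1 (Ordinal m_lt))/=.
    by rewrite !exp1n !muln1 addnA leq_addr.
  by rewrite -val_eqE/=; lia.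
by rewrite bin_sym addnn -mul2n expnS leq_mul2l/= -mul2n expnM.
Qed.

Definition primorial n := \prod_(1 <= p < n.+1 | prime p) p.

Lemma primorial_gt0 n : 0 < primorial n.
Proof. by rewrite prodn_cond_gt0// => p /prime_gt0. Qed.

Lemma primorialS n :
  primorial n.+1 = primorial n * (if prime n.+1 then n.+1 else 1).
Proof. by rewrite /primorial big_mkcond big_nat_recr//= -big_mkcond. Qed.

Lemma primorial_doubleS_le m :
  primorial m.*2.+1 <= primorial m.+1 * 'C(m.*2.+1, m).
Proof.
rewrite /primorial (@big_cat_nat _ _ _ m.+2)/=; [|lia|lia].
rewrite leq_mul2l; apply/orP; right.
apply: dvdn_leq; first by rewrite bin_gt0; lia.
apply: prod_primes_dvd => p p_pr /andP[p_gt p_lt].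
have : p %| (m.*2.+1)`! by rewrite Euclid_dvd_fact.
rewrite -(@bin_fact _ m); last by lia.
rewrite !Euclid_dvdM// !Euclid_dvd_fact// => /or3P[//|p_le|p_le]; lia.
Qed.

Lemma primorial_le n : primorial n <= 4 ^ n.
Proof.
elim/ltn_ind: n => -[_|n IHn]; first by rewrite /primorial big_geq.
have [n_odd|n_even] := boolP (odd n); last first.
  have -> : n = n./2.*2 by rewrite even_halfK.
  move: n./2 IHn (even_halfK n_even) => m IHn m_eq.
  apply: leq_trans (primorial_doubleS_le m) _.
  case: m IHn m_eq => [_ _|m IHn m_eq].
    by rewrite primorialS /primorial big_geq.
  rewrite (leq_trans (leq_mul (IHn _ _) (bin_doubleS_le _)))//; first by lia.
  by rewrite -expnD leq_exp2l//; lia.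
rewrite primorialS expnSr leq_mul ?IHn//.
by case: ifP => // /even_prime[->|]//=; rewrite n_odd.
Qed.

Definition primepi n := \sum_(1 <= p < n.+1) (prime p : nat).

Lemma primepi_le n : primepi n <= n.
Proof.
apply: leq_trans (leq_sum _ (fun p _ => leq_b1 (prime p))) _.
by rewrite sum_nat_const_nat muln1 subn1.
Qed.

Lemma expn_primepi_le m n : m <= n -> m ^ (primepi n - m) <= 4 ^ n.
Proof.
have [->|m_gt0] := posnP m.
  move=> _; apply: (@leq_trans 1); last by rewrite expn_gt0.
  by rewrite subn0; case: (primepi n) => [|k]; rewrite ?expn0 ?exp0n.
move=> m_le; apply: leq_trans (primorial_le n).
rewrite /primepi /primorial !(@big_cat_nat _ _ _ m.+1 1 n.+1)//=.
apply: (@leq_trans (m ^ \sum_(m.+1 <= p < n.+1) prime p)).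
  by rewrite leq_pexp2l// leq_subLR leq_add2r primepi_le.
rewrite -[leqLHS]mul1n leq_mul ?primorial_gt0// expn_sum.
rewrite [leqRHS]big_mkcond big_nat_cond [leqRHS]big_nat_cond.
by apply: leq_prod => p /andP[/andP[/ltnW m_p _] _]; case: prime; rewrite ?expn1.
Qed.

Lemma leq_trunc_logE p i n : 1 < p -> 0 < n -> (i <= trunc_log p n) = (p ^ i <= n).
Proof.
move=> p_gt1 n_gt0; apply/idP/idP => [i_le|]; last exact: trunc_log_max.
by apply: leq_trans (trunc_logP p_gt1 n_gt0); rewrite leq_exp2l.
Qed.

Lemma trunc_log_sum p n : 1 < p -> 0 < n ->
  trunc_log p n = \sum_(1 <= i < n.+1) (p ^ i <= n).
Proof.
move=> p_gt1 n_gt0; have log_lt : trunc_log p n < n.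
  apply: leq_trans (ltn_expl _ p_gt1) _; exact: trunc_logP.
transitivity (\sum_(1 <= i < (trunc_log p n).+1) 1).
  by rewrite sum_nat_const_nat muln1 subn1.
rewrite (@big_nat_widen _ _ _ _ _ n.+1); last exact: ltnW.
by rewrite big_mkcond; apply: eq_bigr => i _; rewrite ltnS leq_trunc_logE//; case: leqP.
Qed.

Lemma logn_fact_widen p k n : prime p -> k <= n ->
  logn p k`! = \sum_(1 <= i < n.+1) k %/ p ^ i.
Proof.
move=> p_pr k_le; rewrite logn_fact// (@big_cat_nat _ _ _ k.+1 1 n.+1)//=.
rewrite [X in _ = _ + X]big_nat_cond [X in _ = _ + X]big1 ?addn0//.
move=> i /andP[/andP[k_lt _] _]; rewrite divn_small// (leq_trans k_lt)//.
by rewrite ltnW// ltn_expl// prime_gt1.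
Qed.

Lemma logn_bin_le p n k : prime p -> 0 < n -> logn p 'C(n, k) <= trunc_log p n.
Proof.
move=> p_pr n_gt0; have [n_lt|k_le] := ltnP n k; first by rewrite bin_small ?logn0.
rewrite trunc_log_sum ?prime_gt1// -(leq_add2r (logn p (k`! * (n - k)`!))).
rewrite -lognM ?bin_gt0 ?muln_gt0 ?fact_gt0// bin_fact// lognM ?fact_gt0//.
rewrite !(@logn_fact_widen _ _ n)// ?leq_subr// -!big_split/=.
apply: leq_sum => i _; have [pi_le|pi_gt] := leqP (p ^ i) n; last by rewrite divn_small.
by rewrite -[n in leqLHS](subnKC k_le) [leqRHS]addnC leq_divDl.
Qed.

Lemma pfactor_bin_le p n k : prime p -> 0 < n -> p ^ logn p 'C(n, k) <= n.
Proof. by move=> p_pr n_gt0; rewrite -leq_trunc_logE ?prime_gt1// logn_bin_le. Qed.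

Lemma bin_le_expn_primepi n k : 'C(n, k) <= n ^ primepi n.
Proof.
have [n_lt|k_le] := ltnP n k; first by rewrite bin_small.
have bin_pos : 0 < 'C(n, k) by rewrite bin_gt0.
have p_le p : p \in primes 'C(n, k) -> prime p /\ p <= n.
  rewrite mem_primes => /and3P[p_pr _ p_dvd]; split=> //.
  by rewrite -Euclid_dvd_fact// -(bin_fact k_le) dvdn_mulr.
rewrite {1}[X in X <= _]prod_prime_decomp// prime_decompE big_map/=.
apply: (@leq_trans (\prod_(p <- primes 'C(n, k)) n)).
  rewrite big_seq [leqRHS]big_seq; apply: leq_prod => p /p_le[p_pr p_n].
  exact/pfactor_bin_le/(leq_trans (prime_gt0 p_pr)).
rewrite big_const_seq iter_muln muln1 count_predT.
have size_le : size (primes 'C(n, k)) <= primepi n.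
  rewrite /primepi -big_mkcond sum1_count -size_filter.
  apply: uniq_leq_size => [|p /p_le[p_pr p_n]]; first exact: primes_uniq.
  by rewrite mem_filter p_pr mem_index_iota prime_gt0.
case: (posnP n) => [n0|n_gt0]; last by rewrite leq_pexp2l.
by move: k_le; rewrite n0 leqn0 => /eqP ->; rewrite bin0 /primepi big_geq.
Qed.

Lemma exp2_leq_bin_double n : 2 ^ n <= 'C(n.*2, n).
Proof.
elim: n => // n IHn.
have := mul_bin_diag n.*2.+2 n; have := mul_bin_down n.*2.+1 n => /=.
rewrite (_ : n.*2.+1 - n = n.+1); last by lia.
rewrite expnS doubleS -(@leq_pmul2l n.+1)// => bin_down <-.
rewrite mulnCA; nia.
Qed.

Lemma exp2_le_expn_primepi n : 2 ^ n <= n.*2 ^ primepi n.*2.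
Proof. exact: leq_trans (exp2_leq_bin_double n) (bin_le_expn_primepi _ _). Qed.

Lemma primepi_exp4_le j : (primepi (4 ^ j) - 2 ^ j) * j <= 2 * 4 ^ j.
Proof.
have : (2 ^ j) ^ (primepi (4 ^ j) - 2 ^ j) <= (2 ^ 2) ^ 4 ^ j.
  by apply: expn_primepi_le; case: j => // j; rewrite leq_exp2r.
by rewrite -!expnM leq_exp2l// mulnC.
Qed.

Lemma primepi_exp4_ge j : 0 < j -> 4 ^ j <= 4 * j * primepi (4 ^ j).
Proof.
case: j => // j _; have := exp2_le_expn_primepi (2 * 4 ^ j).
have -> : (2 * 4 ^ j).*2 = 4 ^ j.+1 by rewrite expnS; lia.
move: (primepi _) => k; rewrite -{1}[4 ^ j.+1]/((2 ^ 2) ^ j.+1).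
by rewrite -!expnM leq_exp2l// expnS; lia.
Qed.

Lemma exists_prime_exp4 j : 0 < j -> exists2 q, prime q & 4 ^ j < q <= 4 ^ (j + 3).
Proof.
move=> j_gt0.
have [/hasP[q]|/hasPn no_prime] :=
    boolP (has prime (index_iota (4 ^ j).+1 (4 ^ (j + 3)).+1)).
  by rewrite mem_index_iota => q_in q_pr; exists q.
have primepi_eq : primepi (4 ^ (j + 3)) = primepi (4 ^ j).
  rewrite /primepi (@big_cat_nat _ _ _ (4 ^ j).+1 1)//= ?ltnS ?leq_exp2l ?leq_addr//.
  rewrite [X in _ + X]big_seq [X in _ + X]big1 ?addn0// => q /no_prime.
  by move/negbTE->.
have := @primepi_exp4_ge (j + 3); have := primepi_exp4_le j.
rewrite primepi_eq addn_gt0 orbT expnD => pi_le /(_ isT) pi_ge.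
have := ltn_expl j (isT : 1 < 2); have four_sqr : 4 ^ j = 2 ^ j * 2 ^ j.
  by rewrite -expnMn.
rewrite four_sqr in pi_le pi_ge; move: (primepi _) pi_le pi_ge => m.
move: (2 ^ j) => t pi_le pi_ge j_lt.
exfalso.
have : m * j <= 3 * (t * t) by nia.
nia.
Qed.

End Chebyshev.

(** * Prime power decompositions *)

Section PrimePowers.
Implicit Types (d e k m n p x : nat).

Lemma pfactor_ind (P : nat -> Prop) :
    P 1%N ->
    (forall p k m, prime p -> (0 < k)%N -> (0 < m)%N -> ~~ (p %| m)%N ->
      P m -> P (p ^ k * m)%N) ->
  forall n, (0 < n)%N -> P n.
Proof.
move=> P1 Pmul; elim/ltn_ind => n IHn n_gt0.
have [n_le1|n_gt1] := leqP n 1; first by rewrite (_ : n = 1%N)//; lia.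
have p_pr := pdiv_prime n_gt1; set p := pdiv n in p_pr.
have [m co_pm n_eq] := pfactor_coprime p_pr n_gt0.
have k_gt0 : (0 < logn p n)%N by rewrite logn_gt0 mem_primes p_pr n_gt0 pdiv_dvd.
have m_gt0 : (0 < m)%N by move: n_gt0; rewrite n_eq muln_gt0 => /andP[].
rewrite n_eq mulnC; apply: Pmul => //; first by rewrite -prime_coprime.
apply: IHn => //; rewrite n_eq ltn_Pmulr//.
by rewrite -(expn0 p) ltn_exp2l// prime_gt1.
Qed.

Lemma sum_dvdn_eq (V : nmodType) (F : nat -> V) d x : (0 < d)%N ->
  \sum_(1 <= n < x.+1 | (d %| n)%N) F n = \sum_(1 <= j < (x %/ d).+1) F (d * j)%N.
Proof.
move=> d_gt0; rewrite -[LHS]big_filter -(big_map (fun j => d * j)%N xpredT F).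
apply: perm_big; apply: uniq_perm.
- by rewrite filter_uniq ?iota_uniq.
- by rewrite map_inj_uniq ?iota_uniq// => i j /eqP; rewrite eqn_pmul2l// => /eqP.
move=> n; rewrite mem_filter mem_index_iota; apply/idP/mapP.
  move=> /and3P[/dvdnP[j ->] n_gt0 n_lt]; exists j; last by rewrite mulnC.
  rewrite mem_index_iota ltnS leq_divRL// (n_lt : (j * d <= x)%N) andbT.
  by move: n_gt0; rewrite muln_gt0 => /andP[].
move=> [j]; rewrite mem_index_iota => /andP[j_gt0 j_le] ->.
by rewrite dvdn_mulr//= muln_gt0 d_gt0 j_gt0/= ltnS mulnC -leq_divRL.
Qed.

Lemma sum_logn_eq (V : nmodType) (F : nat -> V) p k x : prime p ->
  \sum_(1 <= d < x.+1 | logn p d == k) F d =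
  \sum_(1 <= m < (x %/ p ^ k).+1 | ~~ (p %| m)%N) F (p ^ k * m)%N.
Proof.
move=> p_pr; have pk_gt0 : (0 < p ^ k)%N by rewrite expn_gt0 prime_gt0.
transitivity (\sum_(1 <= d < x.+1 | (p ^ k %| d)%N) if logn p d == k then F d else 0).
  rewrite big_mkcond [RHS]big_mkcond; apply: eq_big_nat => d /andP[d_gt0 _].
  by rewrite pfactor_dvdn//; case: eqVneq => [->|_]; rewrite ?leqnn//; case: ifP.
rewrite sum_dvdn_eq// [RHS]big_mkcond; apply: eq_big_nat => m /andP[m_gt0 _].
rewrite lognM// pfactorK// -[X in _ == X]addn0 eqn_add2l -leqn0 leqNgt.
by rewrite logn_gt0 mem_primes p_pr m_gt0.
Qed.

Lemma perm_primesM m n : (0 < m)%N -> (0 < n)%N -> coprime m n ->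
  perm_eq (primes (m * n)) (primes m ++ primes n).
Proof.
move=> m_gt0 n_gt0 co_mn; apply: uniq_perm.
- exact: primes_uniq.
- by rewrite cat_uniq !primes_uniq -coprime_has_primes// co_mn.
- by move=> p; rewrite mem_cat primesM.
Qed.

Lemma perm_divisorsM m n : (0 < m)%N -> (0 < n)%N -> coprime m n ->
  perm_eq (divisors (m * n)) [seq (d * e)%N | d <- divisors m, e <- divisors n].
Proof.
move=> m_gt0 n_gt0 co_mn; have mn_gt0 : (0 < m * n)%N by rewrite muln_gt0 m_gt0.
apply: uniq_perm; first exact: divisors_uniq.
  apply: allpairs_uniq; rewrite ?divisors_uniq//.
  have gcd_m d e : (d %| m)%N -> (e %| n)%N -> gcdn m (d * e) = d.
    move=> d_m e_n; rewrite Gauss_gcdl; first exact/gcdn_idPr.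
    exact: coprime_dvdr co_mn.
  move=> _ _ /allpairsP[[d e]/= [d_m e_n ->]] /allpairsP[[d' e']/= [d'_m e'_n ->]]/=.
  rewrite -!dvdn_divisors// in d_m e_n d'_m e'_n => de_eq.
  have d_eq : d = d' by rewrite -(gcd_m d e)// de_eq gcd_m.
  have d_gt0 : (0 < d)%N by exact: dvdn_gt0 d_m.
  by move/eqP: de_eq; rewrite -d_eq eqn_pmul2l// => /eqP ->.
move=> d; rewrite -dvdn_divisors//.
apply/idP/allpairsP => [d_mn|[[a b]/= []]]; last first.
  by rewrite -!dvdn_divisors// => a_m b_n ->; exact: dvdn_mul.
exists (gcdn d m, d %/ gcdn d m)%N; split=> /=.
- by rewrite -dvdn_divisors// dvdn_gcdr.
- have d_gt0 : (0 < d)%N by exact: dvdn_gt0 d_mn.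
  rewrite -dvdn_divisors// dvdn_divLR ?gcdn_gt0 ?d_gt0 ?dvdn_gcdl//.
  by rewrite muln_gcdr dvdn_gcd dvdn_mull//= mulnC.
- by rewrite mulnC divnK// dvdn_gcdl.
Qed.

Lemma perm_divisors_pfactor p k : prime p ->
  perm_eq (divisors (p ^ k)) [seq (p ^ j)%N | j <- index_iota 0 k.+1].
Proof.
move=> p_pr; apply: uniq_perm; first exact: divisors_uniq.
  rewrite map_inj_uniq ?iota_uniq// => i j /eqP.
  by rewrite eqn_exp2l ?prime_gt1// => /eqP.
move=> d; rewrite -dvdn_divisors ?expn_gt0 ?prime_gt0//.
apply/(dvdn_pfactor _ _ p_pr)/mapP => -[j j_le ->]; exists j => //.
  by rewrite mem_index_iota.
by move: j_le; rewrite mem_index_iota.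
Qed.

Lemma perm_divisors_filter n x : (0 < n <= x)%N ->
  perm_eq (divisors n) [seq d <- index_iota 1 x.+1 | (d %| n)%N].
Proof.
move=> /andP[n_gt0 n_le]; apply: uniq_perm; first exact: divisors_uniq.
  by rewrite filter_uniq ?iota_uniq.
move=> d; rewrite -dvdn_divisors// mem_filter mem_index_iota ltnS.
apply/idP/andP => [d_n|[]//]; split=> //.
by rewrite (dvdn_gt0 n_gt0 d_n)/= (leq_trans _ n_le)// dvdn_leq.
Qed.

End PrimePowers.

(** * Logarithms and sums over primes *)

Section LogarithmSums.
Variable R : realType.
Implicit Types (x : R) (k m n p : nat).

Lemma ln_ge1BV x : 0 < x -> 1 - x^-1 <= ln x.
Proof.
move=> x_gt0; have Vx_gt0 : 0 < x^-1 by rewrite invr_gt0.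
rewrite -[x in ln x]invrK lnV ?posrE// lerNr opprB.
by have := @le_ln1Dx R (x^-1 - 1); rewrite subrKC; apply; lra.
Qed.

Lemma ln_leB1 x : 0 < x -> ln x <= x - 1.
Proof. by move=> x_gt0; have := @le_ln1Dx R (x - 1); rewrite subrKC; apply; lra. Qed.

Lemma ln2_ge : 1 / 2 <= ln 2 :> R.
Proof. by have := @ln_ge1BV 2 ltac:(lra); lra. Qed.

Lemma ln4_le : ln 4 <= 2 :> R.
Proof.
have -> : 4 = 2 ^+ 2 :> R by ring.
by rewrite lnXn// mulr2n; have := @ln_leB1 2 ltac:(lra); lra.
Qed.

Lemma ln_nat_ge0 n : 0 <= ln n%:R :> R.
Proof. by case: n => [|n]; [rewrite ln0|rewrite ln_ge0// ler1n]. Qed.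

Lemma ler_ln_nat m n : (0 < m)%N -> (m <= n)%N -> ln m%:R <= ln n%:R :> R.
Proof.
by move=> m_gt0 m_le; rewrite ler_ln ?posrE ?ltr0n ?ler_nat// (leq_trans m_gt0).
Qed.

Lemma ln_natS_sub_le n : (0 < n)%N -> ln n.+1%:R - ln n%:R <= n%:R^-1 :> R.
Proof.
move=> n_gt0; have n_gt0R : 0 < n%:R :> R by rewrite ltr0n.
rewrite -ln_div ?posrE//; apply: le_trans (ln_leB1 _) _; first by rewrite divr_gt0.
by rewrite -natr1 mulrDl divff ?gt_eqF// mul1r addrC addKr.
Qed.

Lemma ln_natS_sub_ge n : (0 < n)%N -> n.+1%:R^-1 <= ln n.+1%:R - ln n%:R :> R.
Proof.
move=> n_gt0; have n_gt0R : 0 < n%:R :> R by rewrite ltr0n.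
rewrite -ln_div ?posrE//; apply: le_trans (ln_ge1BV _); last by rewrite divr_gt0.
by rewrite invf_div -[n%:R](addrK 1) natr1 mulrBl divff// opprB subrKC mul1r.
Qed.

Lemma ln_prod_nat (r : seq nat) (P : pred nat) (F : nat -> nat) :
    (forall i, P i -> (0 < F i)%N) ->
  ln (\prod_(i <- r | P i) F i)%N%:R = \sum_(i <- r | P i) ln (F i)%:R :> R.
Proof.
move=> F_gt0; elim: r => [|i r IHr]; first by rewrite !big_nil ln1.
rewrite !big_cons; case: ifP => // Pi.
by rewrite natrM lnM ?posrE ?ltr0n ?IHr ?F_gt0// prodn_cond_gt0.
Qed.

Definition chebyshev_theta n : R := \sum_(1 <= p < n.+1 | prime p) ln p%:R.

Lemma chebyshev_theta_le n : chebyshev_theta n <= 2 * n%:R.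
Proof.
rewrite /chebyshev_theta -(ln_prod_nat _ (F := id)); last by move=> p /prime_gt0.
apply: le_trans (ler_ln_nat (primorial_gt0 n) (primorial_le n)) _.
by rewrite natrX lnXn// -[ln 4 *+ n]mulr_natr ler_wpM2r// ln4_le.
Qed.

Lemma harmonic_sum_le n : (0 < n)%N ->
  \sum_(1 <= j < n.+1) j%:R^-1 <= 1 + ln n%:R :> R.
Proof.
elim: n => // -[|n] IHn _; first by rewrite big_nat1 ln1 invr1 addr0.
rewrite big_nat_recr//=.
apply: le_trans (lerD (IHn isT) (ln_natS_sub_ge (ltn0Sn n))) _.
by rewrite -addrA subrKC.
Qed.

Definition recip_primes n : R := \sum_(1 <= p < n.+1 | prime p) p%:R^-1.

Lemma recip_primes_ge0 n : 0 <= recip_primes n.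
Proof. by apply: sumr_ge0. Qed.

Lemma recip_primes_mono m n : (m <= n)%N -> recip_primes m <= recip_primes n.
Proof.
move=> m_le; rewrite /recip_primes (@big_cat_nat _ _ _ m.+1 1 n.+1)//= lerDl.
exact: sumr_ge0.
Qed.

Lemma recip_primes_dyadic_le k : (0 < k)%N ->
  \sum_((2 ^ k).+1 <= p < (2 ^ k.+1).+1 | prime p) p%:R^-1 <= 8 / k%:R :> R.
Proof.
move=> k_gt0; have k_gt0R : 0 < k%:R :> R by rewrite ltr0n.
have pow_gt0 : 0 < 2 ^+ k :> R by rewrite exprn_gt0.
have theta_le :
    \sum_((2 ^ k).+1 <= p < (2 ^ k.+1).+1 | prime p) ln p%:R <= 4 * 2 ^+ k :> R.
  apply: (@le_trans _ _ (chebyshev_theta (2 ^ k.+1))); last first.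
    by apply: le_trans (chebyshev_theta_le _) _; rewrite natrX exprS mulrA -natrM.
  rewrite /chebyshev_theta (@big_cat_nat _ _ _ (2 ^ k).+1 1)//= ?ltnS ?leq_exp2l//.
  by rewrite lerDr sumr_ge0// => p _; exact: ln_nat_ge0.
have recip_le p : (2 ^ k < p)%N -> p%:R^-1 <= 2 / (k%:R * 2 ^+ k) * ln p%:R :> R.
  move=> p_gt; have p_ge : 2 ^+ k <= p%:R :> R by rewrite -natrX ler_nat ltnW.
  have p_gt0 : 0 < p%:R :> R by exact: lt_le_trans p_ge.
  have ln_ge : k%:R / 2 <= ln p%:R :> R.
    apply: (@le_trans _ _ (ln (2 ^+ k))); last by rewrite ler_ln ?posrE.
    by rewrite lnXn// -[ln 2 *+ k]mulr_natl ler_wpM2l//; have := ln2_ge; lra.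
  apply: (@le_trans _ _ (2 ^+ k)^-1); first by rewrite lef_pV2 ?posrE.
  rewrite [leLHS](_ : _ = 2 / (k%:R * 2 ^+ k) * (k%:R / 2)).
    by rewrite ler_wpM2l// divr_ge0// ltW// mulr_gt0.
  by field; rewrite !gt_eqF.
apply: (@le_trans _ _ (2 / (k%:R * 2 ^+ k) * (4 * 2 ^+ k))); last first.
  by rewrite [leLHS](_ : _ = 8 / k%:R)//; field; rewrite !gt_eqF.
apply: le_trans (ler_wpM2l _ theta_le); last by rewrite divr_ge0// ltW// mulr_gt0.
rewrite mulr_sumr big_nat_cond [leRHS]big_nat_cond.
by apply: ler_sum => p /andP[/andP[p_gt _] _]; exact: recip_le.
Qed.

Lemma recip_primes_exp2 k : (0 < k)%N -> recip_primes (2 ^ k) <= 9 + 8 * ln k%:R.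
Proof.
move=> k_gt0; suff dyadic : recip_primes (2 ^ k) <= 1 / 2 + \sum_(1 <= j < k) 8 / j%:R.
  apply: (le_trans dyadic); rewrite -mulr_sumr.
  have : \sum_(1 <= j < k) j%:R^-1 <= 1 + ln k%:R :> R; last by lra.
  by apply: le_trans (harmonic_sum_le k_gt0); rewrite big_nat_recr//= lerDl.
elim: k k_gt0 => // -[_ _|k IHk _].
  rewrite [in leRHS]big_geq// /recip_primes big_mkcond/= expn1.
  by rewrite big_nat_recr//= big_nat1/=; lra.
rewrite /recip_primes (@big_cat_nat _ _ _ (2 ^ k.+1).+1)//= ?ltnS ?leq_exp2l//.
by rewrite big_nat_recr//= addrA lerD ?recip_primes_dyadic_le// IHk.
Qed.

Lemma recip_primes_le n : (0 < n)%N -> recip_primes n <= 9 + 8 * ln (1 + 2 * ln n%:R).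
Proof.
move=> n_gt0; have /andP[log_le n_lt] := trunc_log_bounds (isT : 1 < 2)%N n_gt0.
apply: le_trans (recip_primes_mono (ltnW n_lt)) _.
apply: le_trans (recip_primes_exp2 _) _ => //; rewrite lerD2l ler_pM2l//.
have log_ln : (trunc_log 2 n)%:R * ln 2 <= ln n%:R :> R.
  by rewrite mulr_natl -lnXn// ler_ln ?posrE ?ltr0n ?exprn_gt0// -natrX ler_nat.
rewrite ler_ln ?posrE//; last by have := ln_nat_ge0 n; lra.
by rewrite -natr1; have := ler_wpM2l (ler0n R (trunc_log 2 n)) ln2_ge; lra.
Qed.

Lemma sum_ln_div_sqr_le n : \sum_(2 <= a < n.+2) ln a%:R / a%:R ^+ 2 <= 2 :> R.
Proof.
suff sum_le : \sum_(2 <= a < n.+2) ln a%:R / a%:R ^+ 2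
    <= 2 - (ln n.+1%:R + 2) / n.+1%:R :> R.
  by apply: (le_trans sum_le); rewrite gerBl divr_ge0// addr_ge0// ln_nat_ge0.
elim: n => [|n IHn]; first by rewrite big_geq// ln1; lra.
rewrite big_nat_recr//=; apply: le_trans (lerD IHn (lexx _)) _.
have := @ln_natS_sub_le n.+1 isT; have := ln_nat_ge0 n.+2.
have : 1 <= n.+1%:R :> R by rewrite ler1n.
rewrite -[n.+2%:R]natr1; move: (n.+1%:R : R) => b b_ge1.
move: (ln (b + 1)) (ln b) => l' l l'_ge0 l_sub; rewrite -subr_ge0.
have -> : 2 - (l' + 2) / (b + 1) - (2 - (l + 2) / b + l' / (b + 1) ^+ 2) =
  (l + b^-1 - l') / b + l' / (b * (b + 1) ^+ 2) + (b - 1) / (b ^+ 2 * (b + 1)).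
  by field; rewrite !gt_eqF//; lra.
by rewrite !addr_ge0// divr_ge0// ?mulr_ge0 ?exprn_ge0//; lra.
Qed.

Lemma sum_mul_expr_le x n : 0 <= x <= 1 / 2 ->
  \sum_(2 <= k < n.+2) k%:R * x ^+ k <= 6 * x ^+ 2.
Proof.
move=> /andP[x_ge0 x_le].
suff sum_le : \sum_(2 <= k < n.+2) k%:R * x ^+ k
    <= 6 * x ^+ 2 - 2 * n.+3%:R * x ^+ n.+2.
  by apply: (le_trans sum_le); rewrite gerBl mulr_ge0// exprn_ge0.
elim: n => [|n IHn]; first by rewrite big_geq//; lra.
rewrite big_nat_recr//=; apply: le_trans (lerD IHn (lexx _)) _.
have : 0 <= x ^+ n.+2 * ((n.+2%:R + 2) * (1 - 2 * x)).
  have pow_ge0 : 0 <= x ^+ n.+2 := exprn_ge0 n.+2 x_ge0.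
  have nat_ge0 := ler0n R n.+2.
  by apply: mulr_ge0 => //; apply: mulr_ge0; lra.
by rewrite [x ^+ n.+3]exprS -[n.+4%:R]natr1 -[n.+3%:R]natr1; lra.
Qed.

Lemma sum_invsqr_le n : \sum_(1 <= e < n.+1) (e%:R ^+ 2)^-1 <= 2 :> R.
Proof.
case: n => [|n]; first by rewrite big_geq.
suff sum_le : \sum_(1 <= e < n.+2) (e%:R ^+ 2)^-1 <= 2 - n.+1%:R^-1 :> R.
  by apply: (le_trans sum_le); rewrite gerBl.
elim: n => [|n IHn]; first by rewrite big_nat1; lra.
rewrite big_nat_recr//=; apply: le_trans (lerD IHn (lexx _)) _.
rewrite -[n.+2%:R]natr1; have : 1 <= n.+1%:R :> R by rewrite ler1n.
move: (n.+1%:R : R) => b b_ge1; rewrite -subr_ge0.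
have -> : 2 - (b + 1)^-1 - (2 - b^-1 + ((b + 1) ^+ 2)^-1) = (b * (b + 1) ^+ 2)^-1.
  by field; rewrite !gt_eqF//; lra.
by rewrite invr_ge0 !mulr_ge0//; lra.
Qed.

Lemma sum_prime_invsqr_even_le m :
  \sum_(1 <= p < m.+2.*2.+1 | prime p) (p%:R ^+ 2)^-1 <=
    1 / 4 + 1 / 9 + (1 / 4 - m.+2.*2%:R^-1) / 2 :> R.
Proof.
elim: m => [|m IHm].
  rewrite big_mkcond/= /index_iota/= !big_cons big_nil/= (_ : 2.*2 = 4)%N//.
  by rewrite -!natrX; lra.
rewrite [m.+3.*2]doubleS big_mkcond/= 2?big_nat_recr//= -big_mkcond/=.
rewrite [X in _ + X]ifF; last first.
  by apply/negbTE/negP => /even_prime[|]; [lia|rewrite /= odd_double].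
rewrite addr0; apply: le_trans (lerD IHm (lexx _)) _.
rewrite -[m.+2.*2.+2%:R]natr1 -[m.+2.*2.+1%:R]natr1.
have : 1 <= m.+2.*2%:R :> R by rewrite ler1n; lia.
move: (m.+2.*2%:R : R) => t t_ge1.
apply: (@le_trans _ _ (1 / 4 + 1 / 9 + (1 / 4 - t^-1) / 2 + ((t + 1) ^+ 2)^-1)).
  by rewrite lerD2l; case: ifP => // _; rewrite invr_ge0 exprn_ge0//; lra.
rewrite -subr_ge0.
have -> : 1 / 4 + 1 / 9 + (1 / 4 - (t + 1 + 1)^-1) / 2 -
   (1 / 4 + 1 / 9 + (1 / 4 - t^-1) / 2 + ((t + 1) ^+ 2)^-1) =
   (t * (t + 2) * (t + 1) ^+ 2)^-1.
  by field; rewrite !gt_eqF//; lra.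
by rewrite invr_ge0 !mulr_ge0//; lra.
Qed.

Lemma sum_prime_invsqr_le n :
  \sum_(1 <= p < n.+1 | prime p) (p%:R ^+ 2)^-1 <= 35 / 72 :> R.
Proof.
apply: (@le_trans _ _ (\sum_(1 <= p < n.+2.*2.+1 | prime p) (p%:R ^+ 2)^-1)).
  rewrite (@big_cat_nat _ _ _ n.+1 1 n.+2.*2.+1)//=; last by lia.
  by rewrite lerDl sumr_ge0// => p _; rewrite invr_ge0 exprn_ge0.
apply: le_trans (sum_prime_invsqr_even_le n) _.
by have : 0 <= n.+2.*2%:R^-1 :> R by []; lra.
Qed.

End LogarithmSums.

(** * Turan's inequality and squarefree numbers *)

Section Turan.
Variable R : realType.
Implicit Types d m n p x : nat.

Lemma natr_divn_le n d : (n %/ d)%:R <= n%:R / d%:R :> R.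
Proof.
have [->|d_gt0] := posnP d; first by rewrite divn0 invr0 mulr0.
by rewrite ler_pdivlMr ?ltr0n// -natrM ler_nat leq_divM.
Qed.

Lemma natr_divn_ge n d : (0 < d)%N -> n%:R / d%:R - 1 <= (n %/ d)%:R :> R.
Proof.
move=> d_gt0; rewrite lerBlDr ler_pdivrMr ?ltr0n// natr1 -natrM ler_nat.
by rewrite ltnW// ltn_ceil.
Qed.

Lemma sum_dvdn d x : \sum_(1 <= n < x.+1) (d %| n)%:R = (x %/ d)%:R :> R.
Proof. by rewrite divn_count_dvd natr_sum. Qed.

Lemma sum_dvdn_le d x : \sum_(1 <= n < x.+1) (d %| n)%:R <= x%:R / d%:R :> R.
Proof. by rewrite sum_dvdn natr_divn_le. Qed.

Definition omega n := size (primes n).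

Lemma omegaM m n : (0 < m)%N -> (0 < n)%N -> coprime m n ->
  omega (m * n) = (omega m + omega n)%N.
Proof.
move=> m_gt0 n_gt0 co_mn.
by rewrite /omega (perm_size (perm_primesM m_gt0 n_gt0 co_mn)) size_cat.
Qed.

Lemma omega_prime p : prime p -> omega p = 1%N.
Proof. by move=> p_pr; rewrite /omega primes_prime. Qed.

Lemma natr_omega n x : (1 <= n < x.+1)%N ->
  (omega n)%:R = \sum_(1 <= p < x.+1 | prime p) (p %| n)%:R :> R.
Proof.
move=> /andP[n_gt0 n_lt]; rewrite /omega -sum1_size natr_sum/=.
have -> : primes n = [seq p <- index_iota 1 x.+1 | prime p && (p %| n)%N].
  apply: (irr_sorted_eq ltn_trans ltnn); first exact: sorted_primes.
    by rewrite sorted_filter ?iota_ltn_sorted//; exact: ltn_trans.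
  move=> p; rewrite mem_primes mem_filter mem_index_iota n_gt0/=.
  apply/andP/andP => [[p_pr p_n]|[/andP[-> ->]]//].
  by rewrite p_pr p_n prime_gt0// (leq_ltn_trans _ n_lt)// dvdn_leq.
by rewrite big_filter big_mkcondr/=; apply: eq_bigr => p _; case: (p %| n)%N.
Qed.

Lemma sum_omega_ge x :
  x%:R * recip_primes R x - x%:R <= \sum_(1 <= n < x.+1) (omega n)%:R.
Proof.
rewrite (eq_big_nat _ _ (fun n => @natr_omega n x)) exchange_big/=.
apply: (@le_trans _ _ (\sum_(1 <= p < x.+1 | prime p) (x%:R / p%:R - 1))).
  rewrite sumrB -mulr_sumr lerD2l lerN2 big_mkcond/=.
  apply: (@le_trans _ _ (\sum_(1 <= p < x.+1) 1)).
    by apply: ler_sum => p _; case: ifP.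
  by rewrite sumr_const_nat subn1.
by apply: ler_sum => p p_pr; rewrite sum_dvdn natr_divn_ge// prime_gt0.
Qed.

Lemma sum_dvdn_coprime_le d e x : coprime d e ->
  \sum_(1 <= n < x.+1) (d %| n)%:R * (e %| n)%:R <= x%:R / d%:R / e%:R :> R.
Proof.
move=> co_de; rewrite -mulrA -invfM -natrM; apply: le_trans (sum_dvdn_le _ _).
by apply: ler_sum => n _; rewrite Gauss_dvd// -natrM mulnb.
Qed.

Lemma sum_dvdn_prime_omega_le p x : prime p -> (p <= x)%N ->
  \sum_(1 <= r < x.+1 | prime r) \sum_(1 <= n < x.+1) (p %| n)%:R * (r %| n)%:R
    <= x%:R / p%:R * recip_primes R x + x%:R / p%:R :> R.
Proof.
move=> p_pr p_le; rewrite big_mkcond (bigD1_seq p)/= ?iota_uniq//; last first.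
  by rewrite mem_index_iota prime_gt0.
rewrite p_pr addrC lerD//; last first.
  by under eq_bigr do rewrite -natrM mulnb andbb; exact: sum_dvdn_le.
rewrite big_mkcond /recip_primes mulr_sumr [leRHS]big_mkcond.
apply: ler_sum => r _; have [->|r_neq]/= := eqVneq r p; first by rewrite p_pr !mulr_ge0.
case: ifP => // r_pr; apply: sum_dvdn_coprime_le.
by rewrite prime_coprime// dvdn_prime2// eq_sym.
Qed.

Lemma sum_omega_sqr_le x : \sum_(1 <= n < x.+1) (omega n)%:R ^+ 2
  <= x%:R * recip_primes R x ^+ 2 + x%:R * recip_primes R x.
Proof.
have -> : \sum_(1 <= n < x.+1) (omega n)%:R ^+ 2 =
    \sum_(1 <= p < x.+1 | prime p) \sum_(1 <= r < x.+1 | prime r)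
      \sum_(1 <= n < x.+1) (p %| n)%:R * (r %| n)%:R :> R.
  under [RHS]eq_bigr do rewrite exchange_big.
  rewrite exchange_big; apply: eq_big_nat => n n_in.
  rewrite (natr_omega n_in) expr2 mulr_suml.
  by apply: eq_bigr => p _; rewrite mulr_sumr.
have -> : x%:R * recip_primes R x ^+ 2 + x%:R * recip_primes R x =
    \sum_(1 <= p < x.+1 | prime p) (x%:R / p%:R * recip_primes R x + x%:R / p%:R).
  by rewrite big_split/= -mulr_suml -mulr_sumr -/(recip_primes R x); ring.
rewrite big_nat_cond [leRHS]big_nat_cond; apply: ler_sum => p /andP[/andP[_ p_le] p_pr].
exact: sum_dvdn_prime_omega_le.
Qed.

Lemma turan_kubilius x :
  \sum_(1 <= n < x.+1) ((omega n)%:R - recip_primes R x) ^+ 2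
    <= 3 * x%:R * recip_primes R x.
Proof.
set mu := recip_primes R x.
have -> : \sum_(1 <= n < x.+1) ((omega n)%:R - mu) ^+ 2 =
    \sum_(1 <= n < x.+1) (omega n)%:R ^+ 2
    - 2 * mu * \sum_(1 <= n < x.+1) (omega n)%:R + x%:R * mu ^+ 2.
  have -> : x%:R * mu ^+ 2 = \sum_(1 <= n < x.+1) mu ^+ 2.
    by rewrite sumr_const_nat subn1 mulr_natl.
  by rewrite mulr_sumr -sumrB -big_split/=; apply: eq_bigr => n _; ring.
have := ler_wpM2l (recip_primes_ge0 R x) (sum_omega_ge x); rewrite -/mu.
by have := sum_omega_sqr_le x; rewrite -/mu; lra.
Qed.

Definition squarefree n := all (fun p => ~~ (p ^ 2 %| n)%N) (primes n).

Lemma squarefree_dvd d n : (0 < n)%N -> (d %| n)%N -> squarefree n -> squarefree d.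
Proof.
move=> n_gt0 d_n /allP n_sqf; apply/allP => p; rewrite mem_primes => /and3P[p_pr _ p_d].
have : ~~ (p ^ 2 %| n)%N by apply: n_sqf; rewrite mem_primes p_pr n_gt0 (dvdn_trans p_d).
by apply: contra => p2_d; apply: dvdn_trans d_n.
Qed.

Lemma squarefree_logn p n : squarefree n -> prime p -> (logn p n <= 1)%N.
Proof.
move=> /allP n_sqf p_pr; have [p_n|] := boolP (p \in primes n).
  have n_gt0 : (0 < n)%N by move: p_n; rewrite mem_primes => /and3P[].
  by rewrite leqNgt -pfactor_dvdn// n_sqf.
by rewrite -logn_gt0 -leqNgt => /leq_trans; apply.
Qed.

Lemma sum_nonsquarefree_le x :
  \sum_(1 <= n < x.+1) (~~ squarefree n)%:R <= 35 / 72 * x%:R :> R.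
Proof.
apply: (@le_trans _ _
    (\sum_(1 <= n < x.+1) \sum_(1 <= p < x.+1 | prime p) (p ^ 2 %| n)%:R)).
  apply: ler_sum_nat => n /andP[n_gt0 n_lt].
  have [_|/allPn/=[p]] := boolP (squarefree n); first by rewrite sumr_ge0.
  rewrite mem_primes negbK => /and3P[p_pr _ p_n] p2_n.
  rewrite big_mkcond (bigD1_seq p)/= ?iota_uniq//.
    by rewrite p_pr p2_n lerDl sumr_ge0// => r _; case: ifP.
  by rewrite mem_index_iota prime_gt0//= (leq_ltn_trans _ n_lt)// dvdn_leq.
rewrite exchange_big/=.
apply: (@le_trans _ _ (\sum_(1 <= p < x.+1 | prime p) x%:R * (p%:R ^+ 2)^-1)).
  by apply: ler_sum => p _; rewrite -natrX sum_dvdn_le.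
by rewrite -mulr_sumr mulrC ler_wpM2r// sum_prime_invsqr_le.
Qed.

End Turan.

(** * Mean values of sparse multiplicative functions *)

Section SparseMeanValues.
Variable R : realType.
Implicit Types (d e k m n p x : nat) (eta : R) (g : nat -> R).

(* Abstracts the absolute value of a multiplicative function that is at most [eta]
   at primes; the values at higher prime powers need not be small, since integers
   with a large square divisor are rare. *)
Record sparse_mult eta g : Prop := SparseMult {
  sparse_ge0 : forall n, 0 <= g n;
  sparse_one : g 1%N <= 1;
  sparse_prime : forall p m, prime p -> ~~ (p %| m)%N -> (0 < m)%N ->
    g (p * m)%N <= eta * g m;
  sparse_pfactor : forall p k m, prime p -> ~~ (p %| m)%N -> (0 < m)%N -> (1 < k)%N ->
    g (p ^ k * m)%N <= 2 * g m }.

Definition square_divisors d : seq nat := [seq e <- index_iota 1 d.+1 | (e ^ 2 %| d)%N].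

Lemma mem_square_divisors d e : (0 < d)%N -> (e \in square_divisors d) = (e ^ 2 %| d)%N.
Proof.
move=> d_gt0; rewrite mem_filter mem_index_iota; apply: andb_idr => e2_d.
have e_gt0 : (0 < e)%N by case: e e2_d => //; rewrite dvd0n; lia.
by rewrite e_gt0 ltnS dvdn_leq// (dvdn_trans _ e2_d)// dvdn_exp.
Qed.

Lemma square_divisors_uniq d : uniq (square_divisors d).
Proof. by rewrite filter_uniq ?iota_uniq. Qed.

Lemma leq_size_square_divisors d d' : (0 < d')%N -> (d %| d')%N ->
  (size (square_divisors d) <= size (square_divisors d'))%N.
Proof.
move=> d'_gt0 d_d'; apply: uniq_leq_size => [|e]; first exact: square_divisors_uniq.
have d_gt0 : (0 < d)%N by exact: dvdn_gt0 d_d'.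
by rewrite !mem_square_divisors// => /dvdn_trans; exact.
Qed.

Lemma double_size_square_divisors p k m :
    prime p -> ~~ (p %| m)%N -> (0 < m)%N -> (1 < k)%N ->
  (2 * size (square_divisors m) <= size (square_divisors (p ^ k * m)))%N.
Proof.
move=> p_pr p_m m_gt0 k_gt1; have p_gt0 := prime_gt0 p_pr.
have pkm_gt0 : (0 < p ^ k * m)%N by rewrite muln_gt0 expn_gt0 p_gt0.
have -> : (2 * size (square_divisors m) =
    size (square_divisors m ++ [seq p * e | e <- square_divisors m]))%N.
  by rewrite size_cat size_map mul2n addnn.
apply: uniq_leq_size => [|e].
  rewrite cat_uniq map_inj_uniq ?square_divisors_uniq//=; last first.
    by move=> a b /eqP; rewrite eqn_pmul2l// => /eqP.
  rewrite andbT; apply/hasPn => _ /mapP[a _ ->]; rewrite mem_square_divisors//.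
  by apply: contra p_m; apply: dvdn_trans; rewrite expnMn dvdn_mulr// dvdn_exp.
rewrite mem_cat => /orP[|/mapP[a + ->]]; rewrite !mem_square_divisors// => sqr_m.
  by rewrite dvdn_mull.
by rewrite expnMn dvdn_mul// dvdn_exp2l.
Qed.

Lemma sparse_le_size_square_divisors eta g d :
    eta <= 1 -> sparse_mult eta g -> (0 < d)%N ->
  g d <= (size (square_divisors d))%:R.
Proof.
move=> eta_le1 [g_ge0 g1 g_prime g_pfactor]; elim/pfactor_ind => //.
move=> p k m p_pr k_gt0 m_gt0 p_m g_le.
have pkm_gt0 : (0 < p ^ k * m)%N by rewrite muln_gt0 expn_gt0 prime_gt0.
have [k_le1|k_gt1] := leqP k 1.
  have k1 : k = 1%N by lia.
  apply: (@le_trans _ _ (g m)).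
    by rewrite k1 expn1; apply: le_trans (g_prime _ _ p_pr p_m m_gt0) _; rewrite ler_piMl.
  by apply: (le_trans g_le); rewrite ler_nat leq_size_square_divisors// dvdn_mull.
apply: le_trans (g_pfactor _ _ _ p_pr p_m m_gt0 k_gt1) _.
apply: (@le_trans _ _ (2 * size (square_divisors m))%:R).
  by rewrite natrM ler_wpM2l.
by rewrite ler_nat double_size_square_divisors.
Qed.

Definition summatory g x : R := \sum_(1 <= d < x.+1) g d.

Lemma summatory_ge0 g x : (forall n, 0 <= g n) -> 0 <= summatory g x.
Proof. by move=> g_ge0; apply: sumr_ge0. Qed.

Lemma summatory_le2 eta g x : eta <= 1 -> sparse_mult eta g -> summatory g x <= 2 * x%:R.
Proof.
move=> eta_le1 g_sparse.
apply: (@le_trans _ _ (\sum_(1 <= d < x.+1) \sum_(1 <= e < x.+1) (e ^ 2 %| d)%:R)).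
  apply: ler_sum_nat => d /andP[d_gt0 d_lt].
  apply: le_trans (sparse_le_size_square_divisors eta_le1 g_sparse d_gt0) _.
  rewrite size_filter -sum1_count big_mkcond natr_sum.
  by rewrite [leRHS](@big_cat_nat _ _ _ d.+1)//= ler_wpDr ?sumr_ge0//.
rewrite exchange_big/=.
apply: (@le_trans _ _ (\sum_(1 <= e < x.+1) x%:R * (e%:R ^+ 2)^-1)).
  by apply: ler_sum => e _; rewrite -natrX sum_dvdn_le.
by rewrite -mulr_sumr mulrC ler_wpM2r// sum_invsqr_le.
Qed.

Lemma sum_logn_eq_le g p k x (c : R) : prime p -> 0 <= c -> (forall n, 0 <= g n) ->
    (forall m, ~~ (p %| m)%N -> (0 < m)%N -> g (p ^ k * m)%N <= c * g m) ->
  \sum_(1 <= d < x.+1 | logn p d == k) g d <= c * summatory g (x %/ p ^ k).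
Proof.
move=> p_pr c_ge0 g_ge0 g_le; rewrite sum_logn_eq// /summatory mulr_sumr big_mkcond/=.
apply: ler_sum_nat => m /andP[m_gt0 _].
by case: ifPn => [p_m|_]; [exact: g_le|rewrite mulr_ge0].
Qed.

Lemma sum_logn_layers g p x : \sum_(1 <= d < x.+1) (logn p d)%:R * g d =
  \sum_(1 <= k < x.+1) k%:R * \sum_(1 <= d < x.+1 | logn p d == k) g d.
Proof.
under [RHS]eq_bigr do rewrite mulr_sumr big_mkcond/=.
rewrite exchange_big/=; apply: eq_big_nat => d /andP[d_gt0 d_lt].
have [logn0|logn_gt0] := posnP (logn p d).
  rewrite logn0 mul0r big_nat_cond big1// => k /andP[/andP[k_gt0 _] _].
  by rewrite ifF// lt_eqF.
rewrite (bigD1_seq (logn p d))/= ?iota_uniq//; last first.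
  by rewrite mem_index_iota logn_gt0 (leq_ltn_trans _ d_lt)// ltnW// ltn_logl.
by rewrite eqxx big1 ?addr0// => k k_neq; rewrite ifF// eq_sym (negbTE k_neq).
Qed.

Lemma sum_logn_mul_le eta g p x : 0 <= eta <= 1 -> sparse_mult eta g -> prime p ->
  \sum_(1 <= d < x.+1) (logn p d)%:R * g d <=
    eta * summatory g (x %/ p) + 24 * x%:R / p%:R ^+ 2.
Proof.
move=> /andP[eta_ge0 eta_le1] g_sparse p_pr; have [g_ge0 _ g_prime g_pfactor] := g_sparse.
have [->|x_gt0] := posnP x.
  by rewrite div0n /summatory !big_geq// !mulr0 mul0r addr0.
rewrite sum_logn_layers big_ltn// mul1r; apply: lerD.
  have := @sum_logn_eq_le g p 1 x eta p_pr eta_ge0 g_ge0; rewrite expn1; apply.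
  by move=> m; exact: g_prime.
have p_ge2 : 2 <= p%:R :> R by rewrite ler_nat prime_gt1.
apply: (@le_trans _ _ (\sum_(2 <= k < x.+1) 4 * x%:R * (k%:R * p%:R^-1 ^+ k))).
  apply: ler_sum_nat => k /andP[k_gt1 _]; rewrite mulrCA ler_wpM2l//.
  apply: (@le_trans _ _ (2 * (2 * (x%:R / (p ^ k)%:R)))); last first.
    by rewrite natrX exprVn; lra.
  apply: (@le_trans _ _ (2 * summatory g (x %/ p ^ k))).
    by apply: sum_logn_eq_le => // m p_m m_gt0; exact: g_pfactor.
  rewrite ler_wpM2l// (le_trans (summatory_le2 _ eta_le1 g_sparse))//.
  by rewrite ler_wpM2l// natr_divn_le.
rewrite -mulr_sumr; case: x x_gt0 => // x _.
have Vp_le : 0 <= (p%:R^-1 : R) <= 1 / 2.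
  by rewrite invr_ge0 ler0n/= -div1r ler_pdivrMr; lra.
apply: le_trans (ler_wpM2l _ (sum_mul_expr_le _ Vp_le)) _ => //.
by rewrite exprVn; lra.
Qed.

Lemma ln_logn d x : (0 < d <= x)%N ->
  ln d%:R = \sum_(1 <= p < x.+1 | prime p) (logn p d)%:R * ln p%:R :> R.
Proof.
move=> /andP[d_gt0 d_le]; rewrite -{1}(partnT d_gt0) (widen_partn _ d_le).
rewrite ln_prod_nat; last by move=> p _; exact: pfactor_gt0.
rewrite big_ltn_cond//= expn0 ln1 add0r [RHS]big_mkcond/=.
apply: eq_big_nat => p /andP[p_gt0 _]; case: ifPn => [p_pr|p_npr].
  by rewrite natrX lnXn ?ltr0n// mulr_natl.
by rewrite lognE (negbTE p_npr) expn0 ln1.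
Qed.

Definition log_summatory g x : R := \sum_(1 <= m < x.+1) g m / m%:R.

Lemma sum_ln_summatory_le g x : (forall n, 0 <= g n) ->
  \sum_(1 <= p < x.+1 | prime p) ln p%:R * summatory g (x %/ p)
    <= 2 * x%:R * log_summatory g x.
Proof.
move=> g_ge0.
have -> : \sum_(1 <= p < x.+1 | prime p) ln p%:R * summatory g (x %/ p) =
    \sum_(1 <= p < x.+1 | prime p) \sum_(1 <= m < x.+1)
      (if (m * p <= x)%N then g m * ln p%:R else 0).
  apply: eq_bigr => p p_pr; rewrite /summatory mulr_sumr.
  rewrite (@big_nat_widen _ _ _ _ _ x.+1) ?ltnS ?leq_div// big_mkcond/=.
  by apply: eq_bigr => m _; rewrite ltnS leq_divRL ?prime_gt0// mulrC.
rewrite exchange_big/= /log_summatory mulr_sumr.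
apply: ler_sum_nat => m /andP[m_gt0 _]; rewrite -big_mkcondr/=.
rewrite [leLHS](_ : _ = g m * chebyshev_theta R (x %/ m)); last first.
  rewrite /chebyshev_theta mulr_sumr.
  rewrite [RHS](@big_nat_widen _ _ _ _ _ x.+1) ?ltnS ?leq_div//.
  by apply: eq_bigl => p; rewrite ltnS leq_divRL// mulnC.
rewrite mulrCA ler_wpM2l// -mulrA (le_trans (chebyshev_theta_le _ _))//.
by rewrite ler_wpM2l// natr_divn_le.
Qed.

(* [ln d] is the sum of [v_p(d) ln p]; the exact prime divisors of [d] contribute a
   factor [eta], the higher powers only [O(x)], and Chebyshev's bound does the rest. *)
Lemma sum_mul_ln_le eta g x : 0 <= eta <= 1 -> sparse_mult eta g ->
  \sum_(1 <= d < x.+1) g d * ln d%:R <= 2 * eta * x%:R * log_summatory g x + 48 * x%:R.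
Proof.
move=> eta01 g_sparse; have /andP[eta_ge0 _] := eta01.
have -> : \sum_(1 <= d < x.+1) g d * ln d%:R =
    \sum_(1 <= p < x.+1 | prime p) ln p%:R * \sum_(1 <= d < x.+1) (logn p d)%:R * g d.
  under [RHS]eq_bigr do rewrite mulr_sumr.
  rewrite exchange_big/=; apply: eq_big_nat => d d_in.
  by rewrite (@ln_logn d x) ?mulr_sumr//; apply: eq_bigr => p _; ring.
apply: (@le_trans _ _ (\sum_(1 <= p < x.+1 | prime p)
    (eta * (ln p%:R * summatory g (x %/ p)) + 24 * x%:R * (ln p%:R / p%:R ^+ 2)))).
  apply: ler_sum => p p_pr.
  by have := ler_wpM2l (ln_nat_ge0 R p) (sum_logn_mul_le x eta01 g_sparse p_pr); lra.
rewrite big_split/= -!mulr_sumr; apply: lerD.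
  by have := ler_wpM2l eta_ge0 (sum_ln_summatory_le x (sparse_ge0 g_sparse)); lra.
suff : \sum_(1 <= p < x.+1 | prime p) ln p%:R / p%:R ^+ 2 <= 2 :> R.
  by move/(ler_wpM2l (ler0n R (24 * x))); rewrite natrM; lra.
have term_ge0 p : 0 <= ln p%:R / p%:R ^+ 2 :> R.
  by rewrite divr_ge0 ?ln_nat_ge0 ?exprn_ge0.
apply: le_trans (sum_ln_div_sqr_le R x); rewrite big_mkcond/=.
case: x => [|x]; first by rewrite !big_geq.
rewrite big_ltn//= add0r [leRHS]big_nat_recr//= ler_wpDr//.
by apply: ler_sum => p _; case: ifP.
Qed.

Lemma sum_mul_ln_ratio_le eta g x : eta <= 1 -> sparse_mult eta g ->
  \sum_(1 <= d < x.+1) g d * (ln x%:R - ln d%:R) <= 2 * x%:R.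
Proof.
move=> eta_le1 g_sparse; elim: x => [|x IHx]; first by rewrite big_geq// mulr0.
rewrite big_nat_recr//= subrr mulr0 addr0.
have [->|x_gt0] := posnP x; first by rewrite big_geq.
have -> : \sum_(1 <= d < x.+1) g d * (ln x.+1%:R - ln d%:R) =
    \sum_(1 <= d < x.+1) g d * (ln x%:R - ln d%:R)
    + (ln x.+1%:R - ln x%:R) * summatory g x.
  by rewrite /summatory mulr_sumr -big_split/=; apply: eq_bigr => d _; ring.
rewrite -[x.+1%:R in leRHS]natr1 mulrDr mulr1 lerD//.
apply: (@le_trans _ _ (x%:R^-1 * (2 * x%:R))).
  apply: ler_pM; rewrite ?ln_natS_sub_le ?subr_ge0 ?ler_ln_nat//.
    exact/summatory_ge0/(sparse_ge0 g_sparse).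
  exact: summatory_le2 eta_le1 g_sparse.
by rewrite mulrCA mulVf ?mulr1// pnatr_eq0 -lt0n.
Qed.

Lemma summatory_mul_ln_le eta g x : 0 <= eta <= 1 -> sparse_mult eta g ->
  summatory g x * ln x%:R <= x%:R * (2 * eta * log_summatory g x + 50).
Proof.
move=> eta01 g_sparse; have /andP[_ eta_le1] := eta01.
have -> : summatory g x * ln x%:R = \sum_(1 <= d < x.+1) g d * ln d%:R +
    \sum_(1 <= d < x.+1) g d * (ln x%:R - ln d%:R).
  by rewrite -big_split mulr_suml/=; apply: eq_bigr => d _; ring.
have := sum_mul_ln_le x eta01 g_sparse.
have := sum_mul_ln_ratio_le x eta_le1 g_sparse; lra.
Qed.

Lemma log_summatory_by_parts g x : (0 < x)%N -> log_summatory g x =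
  summatory g x / x%:R + \sum_(1 <= j < x) summatory g j / (j%:R * j.+1%:R).
Proof.
rewrite /log_summatory; elim: x => // -[|x] IHx _.
  by rewrite /summatory !big_nat1 big_geq// addr0.
rewrite big_nat_recr//= IHx// [X in _ = _ + X]big_nat_recr//=.
have -> : summatory g x.+2 = summatory g x.+1 + g x.+2 by rewrite /summatory big_nat_recr.
move: (summatory g x.+1) (\sum_(_ <= _ < _) _) => a b.
have : 0 < x.+1%:R :> R by rewrite ltr0n.
rewrite -[x.+2%:R]natr1; move: (x.+1%:R : R) => t t_gt0.
by field; rewrite !gt_eqF//; lra.
Qed.

Lemma harmonic_sum_trunc_le (Y : R) x : 0 <= Y ->
  \sum_(1 <= j < x.+1 | ln j%:R < Y) j%:R^-1 <= 1 + Y :> R.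
Proof.
move=> Y_ge0; elim: x => [|x IHx]; first by rewrite big_geq// addr_ge0.
have [ln_lt|ln_ge] := ltP (ln x.+1%:R) Y.
  apply: (@le_trans _ _ (1 + ln x.+1%:R)); last by rewrite lerD2l ltW.
  apply: le_trans (harmonic_sum_le _ _) => //; rewrite big_mkcond/=.
  by apply: ler_sum => j _; case: ifP.
by rewrite big_mkcond/= big_nat_recr//= -big_mkcond/= ltNge ln_ge addr0.
Qed.

Lemma log_summatory_le eta g x (A Y : R) : eta <= 1 -> sparse_mult eta g -> (0 < x)%N ->
    0 <= A -> 0 <= Y ->
    (forall j, (0 < j)%N -> Y <= ln j%:R -> summatory g j <= A * j%:R) ->
  log_summatory g x <= 4 + A + A * ln x%:R + 2 * Y.
Proof.
move=> eta_le1 g_sparse x_gt0 A_ge0 Y_ge0 g_le; rewrite log_summatory_by_parts//.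
have first_le : summatory g x / x%:R <= 2.
  by rewrite ler_pdivrMr ?ltr0n// (summatory_le2 _ eta_le1 g_sparse).
suff rest_le : \sum_(1 <= j < x) summatory g j / (j%:R * j.+1%:R) <=
   A * (1 + ln x%:R) + 2 * (1 + Y) by lra.
apply: (@le_trans _ _
    (\sum_(1 <= j < x.+1) (A * j%:R^-1 + 2 * (if ln j%:R < Y then j%:R^-1 else 0)))).
  rewrite [leRHS]big_nat_recr//= ler_wpDr//.
    by rewrite addr_ge0 ?mulr_ge0//; case: ifP.
  apply: ler_sum_nat => j /andP[j_gt0 _]; have j_gt0R : 0 < j%:R :> R by rewrite ltr0n.
  apply: (@le_trans _ _ (summatory g j / j%:R / j%:R)).
    rewrite -mulrA -invfM ler_wpM2l ?summatory_ge0//; first exact: sparse_ge0 g_sparse.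
    by rewrite lef_pV2 ?posrE ?mulr_gt0// ler_wpM2l ?ler_nat// ltW.
  have [_|ln_ge] := ltP.
    rewrite -mulrDl ler_wpM2r// ler_pdivrMr//.
    by have := summatory_le2 j eta_le1 g_sparse; have := mulr_ge0 A_ge0 (ltW j_gt0R); lra.
  by rewrite mulr0 addr0 ler_wpM2r// ler_pdivrMr// g_le.
rewrite big_split/= -!mulr_sumr -big_mkcond/=.
by rewrite lerD// ler_wpM2l ?harmonic_sum_le ?harmonic_sum_trunc_le.
Qed.

Definition power_saving (D : R) (e i : nat) : Prop :=
  forall eta g x, 0 < eta <= 1 -> sparse_mult eta g -> (0 < x)%N ->
    D <= eta ^+ e * ln x%:R -> summatory g x <= D * eta ^+ i * x%:R.

Lemma power_saving0 : power_saving 2 0 0.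
Proof.
move=> eta g x /andP[_ eta_le1] g_sparse _ _.
by rewrite expr0 mulr1; exact: summatory_le2 eta_le1 g_sparse.
Qed.

(* Partial summation turns the given saving into a bound for [log_summatory], and
   [summatory_mul_ln_le] then gains one more factor [eta]. *)
Lemma power_savingS D e i : 1 <= D -> power_saving D e i ->
  power_saving (8 * D + 58) (e + i.+1) i.+1.
Proof.
move=> D_ge1 saving eta g x /andP[eta_gt0 eta_le1] g_sparse x_gt0 x_large.
have x_gt0R : 0 < x%:R :> R by rewrite ltr0n.
pose u := (eta ^+ e)^-1; pose v := D * eta ^+ i; pose l : R := ln x%:R.
have eta_e_gt0 : 0 < eta ^+ e by exact: exprn_gt0.
have u_ge1 : 1 <= u by rewrite invf_ge1// exprn_ile1// ltW.
have v_ge0 : 0 <= v by rewrite mulr_ge0 ?exprn_ge0// ltW//; lra.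
have v_le : v <= D by rewrite ler_piMr ?exprn_ile1// ltW//; lra.
have saved_ge : (8 * D + 58) * u <= eta ^+ i.+1 * l.
  by rewrite ler_pdivrMr// -/l mulrAC -exprD addnC.
have l_gt0 : 0 < l.
  have : 0 < eta ^+ i.+1 * l by apply: lt_le_trans saved_ge; rewrite mulr_gt0//; lra.
  by rewrite pmulr_rgt0// exprn_gt0.
have log_le : log_summatory g x <= 4 + v + v * l + 2 * (D * u).
  apply: (log_summatory_le eta_le1 g_sparse x_gt0) => // [|j j_gt0 j_large].
    by rewrite mulr_ge0//; lra.
  by apply: saving; rewrite ?eta_gt0// mulrC -ler_pdivrMr.
have eta01 : 0 <= eta <= 1 by rewrite ltW.
have := summatory_mul_ln_le x eta01 g_sparse; rewrite -/l => sum_ln_le.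
rewrite -(ler_pM2r l_gt0); apply: (le_trans sum_ln_le).
rewrite [leRHS](_ : _ = x%:R * (2 * eta * (v * l) + (6 * D + 58) * (eta ^+ i.+1 * l)));
  last by rewrite /v exprS; ring.
rewrite ler_pM2l//.
have eta_log_le := ler_wpM2l (ltW eta_gt0) log_le.
have eta_rest_le : eta * (4 + v + 2 * (D * u)) <= 4 + v + 2 * (D * u).
  by rewrite ler_piMl// !addr_ge0// !mulr_ge0//; lra.
have Du_ge : D <= D * u by rewrite ler_peMr//; lra.
have rest_le : (6 * D + 58) * u <= (6 * D + 58) * (eta ^+ i.+1 * l).
  rewrite ler_wpM2l//; first lra.
  by apply: le_trans saved_ge; rewrite ler_peMl//; lra.
lra.
Qed.

Lemma exists_power_saving i : exists D e, 1 <= D /\ power_saving D e i.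
Proof.
elim: i => [|i [D [e [D_ge1 saving]]]].
  by exists 2, 0%N; split; [lra|exact: power_saving0].
by exists (8 * D + 58), (e + i.+1)%N; split; [lra|exact: power_savingS].
Qed.

End SparseMeanValues.

(** * Möbius inversion and exponential sums *)

Section MobiusTransform.
Variable A : comNzRingType.
Implicit Types (n p d m x k : nat) (F G h : nat -> A).

Definition mult_arith F : Prop := F 1%N = 1 /\
  forall m n, (0 < m)%N -> (0 < n)%N -> coprime m n -> F (m * n)%N = F m * F n.

(* Multiplicativity gives the convolution of [F] with the Möbius function as a
   product over primes. *)
Definition mobius_transform F n : A :=
  \prod_(p <- primes n) (F (p ^ logn p n)%N - F (p ^ (logn p n).-1)%N).

Lemma mobius_transform1 F : mobius_transform F 1 = 1.
Proof. by rewrite /mobius_transform big_nil. Qed.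

Lemma mobius_transform_pfactor F p k : prime p -> (0 < k)%N ->
  mobius_transform F (p ^ k) = F (p ^ k)%N - F (p ^ k.-1)%N.
Proof.
move=> p_pr k_gt0.
by rewrite /mobius_transform primesX// primes_prime// big_seq1 pfactorK.
Qed.

Lemma mobius_transformM F m n : (0 < m)%N -> (0 < n)%N -> coprime m n ->
  mobius_transform F (m * n) = mobius_transform F m * mobius_transform F n.
Proof.
move=> m_gt0 n_gt0 co_mn.
rewrite /mobius_transform (perm_big _ (perm_primesM m_gt0 n_gt0 co_mn)) big_cat/=.
congr (_ * _); rewrite big_seq [RHS]big_seq; apply: eq_bigr => p;
  rewrite mem_primes => /and3P[_ _ p_dvd].
  by rewrite mulnC logn_Gauss// (coprime_dvdl p_dvd).
by rewrite logn_Gauss// (coprime_dvdl p_dvd)// coprime_sym.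
Qed.

Lemma sum_mobius_transform F n : mult_arith F -> (0 < n)%N ->
  \sum_(d <- divisors n) mobius_transform F d = F n.
Proof.
move=> [F1 FM]; elim/pfactor_ind => [|p k m p_pr k_gt0 m_gt0 p_m IHm].
  by rewrite big_seq1 mobius_transform1.
have pk_gt0 : (0 < p ^ k)%N by rewrite expn_gt0 prime_gt0.
have co_pkm : coprime (p ^ k) m by rewrite coprimeXl// prime_coprime.
rewrite (perm_big _ (perm_divisorsM pk_gt0 m_gt0 co_pkm)) big_allpairs_dep FM//=.
transitivity (\sum_(d <- divisors (p ^ k)) mobius_transform F d * F m).
  rewrite big_seq [RHS]big_seq; apply: eq_bigr => d; rewrite -dvdn_divisors// => d_pk.
  rewrite -IHm mulr_sumr big_seq [RHS]big_seq; apply: eq_bigr => e.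
  rewrite -dvdn_divisors// => e_m; rewrite mobius_transformM//.
  - exact: dvdn_gt0 d_pk.
  - exact: dvdn_gt0 e_m.
  - exact: coprime_dvdl d_pk (coprime_dvdr e_m co_pkm).
rewrite -mulr_suml (perm_big _ (perm_divisors_pfactor k p_pr)) big_map/=.
rewrite big_ltn// expn0 mobius_transform1.
have -> : \sum_(1 <= j < k.+1) mobius_transform F (p ^ j) = F (p ^ k)%N - 1.
  rewrite -F1 -[F 1%N]/(F (p ^ 0)%N) -(telescope_sumr (fun j => F (p ^ j)%N))// big_add1.
  by apply: eq_bigr => j _; rewrite mobius_transform_pfactor.
by rewrite subrKC.
Qed.

Lemma sum_convolution h G x :
  \sum_(1 <= n < x.+1) (\sum_(d <- divisors n) h d) * G n =
  \sum_(1 <= d < x.+1) h d * \sum_(1 <= j < (x %/ d).+1) G (d * j)%N.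
Proof.
transitivity (\sum_(1 <= n < x.+1) \sum_(1 <= d < x.+1)
    (if (d %| n)%N then h d * G n else 0)).
  apply: eq_big_nat => n n_in; rewrite (perm_big _ (perm_divisors_filter n_in)).
  by rewrite big_filter mulr_suml big_mkcond.
rewrite exchange_big/=; apply: eq_big_nat => d /andP[d_gt0 _].
by rewrite -big_mkcond/= sum_dvdn_eq// mulr_sumr.
Qed.

End MobiusTransform.

Lemma prime_primitive_root (A : nzRingType) (z : A) q :
  prime q -> z ^+ q = 1 -> z != 1 -> q.-primitive_root z.
Proof.
move=> q_pr zq z_neq1; have [m z_prim m_q] := prim_order_exists (prime_gt0 q_pr) zq.
have /primeP[_ /(_ m m_q)/orP[/eqP m1|/eqP <-//]] := q_pr.
by move: z_neq1; rewrite -[z]expr1 -m1 prim_expr_order ?eqxx.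
Qed.

(* [R[i]] seen as a normed group over [R]; its own norm has values in [R[i]]. *)
Local Notation cnorm := (@Num.norm _ (Rcomplex _)).

Section ExponentialSums.
Variable R : realType.
Implicit Types (d k m n q x : nat) (u z : R[i]) (F h : nat -> R[i]).

Lemma cnorm1 : cnorm 1 = 1 :> R.
Proof. exact: ComplexField.Normc.normc1. Qed.

Lemma cnormM u z : cnorm (u * z) = cnorm u * cnorm z :> R.
Proof. exact: ComplexField.Normc.normcM. Qed.

Lemma cnormX u k : cnorm (u ^+ k) = cnorm u ^+ k :> R.
Proof. by elim: k => [|k IHk]; rewrite ?cnorm1// !exprS cnormM IHk. Qed.

Lemma cnorm_expr1 u k : cnorm u = 1 -> cnorm (u ^+ k) = 1.
Proof. by move=> u1; rewrite cnormX u1 expr1n. Qed.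

Lemma cnorm_unity_root u q : (0 < q)%N -> u ^+ q = 1 -> cnorm u = 1.
Proof.
move=> q_gt0 uq; apply/eqP; by rewrite -(pexpr_eq1 q_gt0)// -cnormX uq cnorm1.
Qed.

Lemma cnorm_exprB_le u k m : cnorm u = 1 ->
  cnorm (u ^+ k - u ^+ m) <= cnorm (u - 1) * `|k%:R - m%:R|.
Proof.
move=> u1; wlog m_le : k m / (m <= k)%N.
  move=> le_of_leq; have [/ltnW|] := ltnP k m; last exact: le_of_leq.
  by move/le_of_leq; rewrite distrC [X in _ <= _ * X]distrC.
have -> : u ^+ k - u ^+ m = u ^+ m * (u ^+ (k - m) - 1).
  by rewrite mulrBr mulr1 -exprD subnKC.
rewrite cnormM cnorm_expr1// mul1r -natrB// normr_nat subrX1 cnormM ler_wpM2l//.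
apply: le_trans (ler_norm_sum _ _ _) _; under eq_bigr do rewrite cnorm_expr1//.
by rewrite sumr_const card_ord.
Qed.

Lemma cnorm_sum_unity_root_le u q x : (0 < q)%N -> u ^+ q = 1 -> u != 1 ->
  cnorm (\sum_(1 <= j < x.+1) u ^+ j) <= q%:R.
Proof.
move=> q_gt0 uq u_neq1; have u1 := cnorm_unity_root q_gt0 uq.
have period0 : \sum_(1 <= j < q.+1) u ^+ j = 0.
  rewrite big_add1/= big_mkord; under eq_bigr do rewrite exprS.
  rewrite -mulr_sumr; have := subrX1 u q; rewrite uq subrr => /esym/eqP.
  by rewrite mulf_eq0 subr_eq0 (negbTE u_neq1)/= => /eqP ->; rewrite mulr0.
elim/ltn_ind: x => x IHx; have [x_lt|q_le] := ltnP x q.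
  apply: le_trans (ler_norm_sum _ _ _) _; under eq_bigr do rewrite cnorm_expr1//.
  by rewrite sumr_const_nat subn1 ler_nat ltnW.
rewrite (@big_cat_nat _ _ _ q.+1)//= period0 add0r.
have -> : \sum_(q.+1 <= j < x.+1) u ^+ j = \sum_(1 <= j < (x - q).+1) u ^+ j.
  rewrite -[q.+1]add1n big_addn subSn//.
  by apply: eq_bigr => j _; rewrite exprD uq mulr1.
by apply: IHx; lia.
Qed.

Lemma exp_sum_convolution_le F h u q x :
    (forall n, (0 < n)%N -> \sum_(d <- divisors n) h d = F n) ->
    (0 < q)%N -> u ^+ q = 1 -> (forall d, (0 < d)%N -> u ^+ d = 1 -> h d = 0) ->
  cnorm (\sum_(1 <= n < x.+1) F n * u ^+ n) <= q%:R * summatory (fun d => cnorm (h d)) x.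
Proof.
move=> F_eq q_gt0 uq h0.
have -> : \sum_(1 <= n < x.+1) F n * u ^+ n =
    \sum_(1 <= n < x.+1) (\sum_(d <- divisors n) h d) * u ^+ n.
  by apply: eq_big_nat => n /andP[n_gt0 _]; rewrite F_eq.
rewrite sum_convolution (le_trans (ler_norm_sum _ _ _))// /summatory mulr_sumr.
apply: ler_sum_nat => d /andP[d_gt0 _]; rewrite cnormM mulrC.
have [ud|ud] := eqVneq (u ^+ d) 1; first by rewrite h0// normr0 !mulr0.
rewrite ler_wpM2r//; under eq_bigr do rewrite exprM.
by rewrite cnorm_sum_unity_root_le// exprAC uq expr1n.
Qed.

Lemma mobius_transform_sparse F (eta : R) : mult_arith F ->
    (forall n, cnorm (F n) = 1) -> (forall p, prime p -> cnorm (F p - 1) <= eta) ->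
  sparse_mult eta (fun d => cnorm (mobius_transform F d)).
Proof.
move=> [F1 _] F_norm1 Fp_near1.
have transform_pfactor p k m : prime p -> ~~ (p %| m)%N -> (0 < m)%N -> (0 < k)%N ->
    cnorm (mobius_transform F (p ^ k * m)) =
    cnorm (F (p ^ k)%N - F (p ^ k.-1)%N) * cnorm (mobius_transform F m).
  move=> p_pr p_m m_gt0 k_gt0.
  have pk_gt0 : (0 < p ^ k)%N by rewrite expn_gt0 prime_gt0.
  rewrite mobius_transformM//; last by rewrite coprimeXl// prime_coprime.
  by rewrite cnormM mobius_transform_pfactor.
split=> [n||p m p_pr p_m m_gt0|p k m p_pr p_m m_gt0 k_gt1].
- exact: normr_ge0.
- by rewrite mobius_transform1 cnorm1.
- by rewrite -{1}(expn1 p) transform_pfactor// expn1 expn0 F1 ler_wpM2r// Fp_near1.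
- rewrite transform_pfactor ?(ltnW k_gt1)// ler_wpM2r//.
  by apply: le_trans (ler_normB _ _) _; rewrite !F_norm1.
Qed.

End ExponentialSums.

(** * Additive functions *)

Section AdditiveFunctions.
Variable w : nat -> nat.
Hypotheses (w_add : additive_arith w) (w_prime : forall p, prime p -> w p = 1%N).
Implicit Types (k m n p q x : nat).

Lemma additive_arith1 : w 1%N = 0%N.
Proof. by have := w_add (ltn0Sn 0) (ltn0Sn 0) (coprime1n 1); rewrite muln1; lia. Qed.

Lemma additive_arith_squarefree n : (0 < n)%N -> squarefree n -> w n = omega n.
Proof.
elim/pfactor_ind => [|p k m p_pr k_gt0 m_gt0 p_m IHm pkm_sqf].
  by rewrite additive_arith1.
have p_gt0 := prime_gt0 p_pr; have co_pm : coprime p m by rewrite prime_coprime.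
have k1 : k = 1%N.
  have := squarefree_logn pkm_sqf p_pr.
  by rewrite lognM ?expn_gt0 ?p_gt0// pfactorK// logn_coprime//; lia.
rewrite k1 expn1 in pkm_sqf *; rewrite w_add// omegaM// w_prime// omega_prime//.
by rewrite IHm// (squarefree_dvd _ (dvdn_mull p (dvdnn m)))// muln_gt0 p_gt0.
Qed.

Variable R : realType.
Variable z : R[i].
Hypothesis z_norm1 : cnorm z = 1.

(* AM-GM: [eta t <= 1 / 144 + 36 (eta t) ^ 2], with [t = n - truncn mu]. *)
Lemma cnorm_exprB_truncn_le n (mu : R) : 0 <= mu ->
  cnorm (z ^+ n - z ^+ Num.truncn mu)
    <= 1 / 144 + 72 * cnorm (z - 1) ^+ 2 * ((n%:R - mu) ^+ 2 + 1).
Proof.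
move=> mu_ge0; apply: le_trans (cnorm_exprB_le _ _ z_norm1) _.
have /andP[] := truncn_itv mu_ge0; rewrite -[(Num.truncn mu).+1%:R]natr1.
move: (cnorm (z - 1)) (n%:R : R) ((Num.truncn mu)%:R : R) => eta s k k_le mu_lt.
apply: (@le_trans _ _ (1 / 144 + 36 * eta ^+ 2 * (s - k) ^+ 2)).
  rewrite -[(s - k) ^+ 2]real_normK ?num_real// -mulrA -exprMn.
  by have := sqr_ge0 (6 * (eta * `|s - k|) - 1 / 12); rewrite !expr2; lra.
have frac_le : (mu - k) ^+ 2 <= 1 by rewrite expr_le1//; lra.
have sqr_le : (s - k) ^+ 2 <= 2 * ((s - mu) ^+ 2 + 1).
  by have := sqr_ge0 ((s - mu) - (mu - k)); move: frac_le; rewrite !expr2; lra.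
by have := ler_wpM2l (sqr_ge0 eta) sqr_le; lra.
Qed.

(* Each non-squarefree number costs at most [2], in total [35/36 x]; Turan's
   inequality makes the squarefree terms agree with one fixed power of [z] up to
   [x / 72] in total. *)
Lemma sum_expr_additive_deviation_le x (mu := recip_primes R x) :
    72 * 144 * (cnorm (z - 1) ^+ 2 * (3 * mu + 1)) <= 1 ->
  \sum_(1 <= n < x.+1) cnorm (z ^+ w n - z ^+ Num.truncn mu) <= 71 / 72 * x%:R.
Proof.
move=> z_near1; have mu_ge0 : 0 <= mu := recip_primes_ge0 R x.
set eta := cnorm (z - 1) in z_near1.
apply: (@le_trans _ _ (\sum_(1 <= n < x.+1) (2 * (~~ squarefree n)%:R +
    (1 / 144 + 72 * eta ^+ 2 * (((omega n)%:R - mu) ^+ 2 + 1))))).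
  apply: ler_sum_nat => n /andP[n_gt0 _].
  have [n_sqf|_] := boolP (squarefree n).
    by rewrite mulr0 add0r additive_arith_squarefree// cnorm_exprB_truncn_le.
  rewrite mulr1 -[leLHS]addr0 lerD//.
    by apply: le_trans (ler_normB _ _) _; rewrite !cnorm_expr1.
  by rewrite addr_ge0// !mulr_ge0 ?normr_ge0// addr_ge0// sqr_ge0.
have -> : \sum_(1 <= n < x.+1) (2 * (~~ squarefree n)%:R +
      (1 / 144 + 72 * eta ^+ 2 * (((omega n)%:R - mu) ^+ 2 + 1))) =
    2 * \sum_(1 <= n < x.+1) (~~ squarefree n)%:R + x%:R * (1 / 144 + 72 * eta ^+ 2) +
    72 * eta ^+ 2 * \sum_(1 <= n < x.+1) ((omega n)%:R - mu) ^+ 2.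
  have -> : x%:R * (1 / 144 + 72 * eta ^+ 2) =
      \sum_(1 <= n < x.+1) (1 / 144 + 72 * eta ^+ 2).
    by rewrite sumr_const_nat subn1 mulr_natl.
  by rewrite !mulr_sumr -!big_split/=; apply: eq_bigr => n _; ring.
have := sum_nonsquarefree_le R x.
have := ler_wpM2l (sqr_ge0 eta) (turan_kubilius R x).
have := ler_wpM2l (ler0n R x) z_near1.
by rewrite -/mu; lra.
Qed.

Lemma cnorm_sum_expr_additive_ge x :
    72 * 144 * (cnorm (z - 1) ^+ 2 * (3 * recip_primes R x + 1)) <= 1 ->
  x%:R / 72 <= cnorm (\sum_(1 <= n < x.+1) z ^+ w n).
Proof.
move=> /sum_expr_additive_deviation_le; set k := Num.truncn _ => deviation_le.
have main_term : cnorm (\sum_(1 <= n < x.+1) z ^+ k) = x%:R.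
  by rewrite sumr_const_nat subn1 normrMn cnorm_expr1.
have := ler_normB (\sum_(1 <= n < x.+1) z ^+ w n : Rcomplex R)
  (\sum_(1 <= n < x.+1) (z ^+ w n - z ^+ k)).
have := le_trans (ler_norm_sum _ _ _) deviation_le.
by rewrite {2}sumrB subKr main_term; lra.
Qed.

Lemma cnorm_sum_expr_additive_coprime_ge x q : prime q -> (144 <= q)%N ->
    72 * 144 * (cnorm (z - 1) ^+ 2 * (3 * recip_primes R x + 1)) <= 1 ->
  x%:R / 144 <= cnorm (\sum_(1 <= n < x.+1 | ~~ (q %| n)%N) z ^+ w n).
Proof.
move=> q_pr q_ge /cnorm_sum_expr_additive_ge.
rewrite (bigID (fun n => q %| n)%N)/= => /le_trans/(_ (ler_normD _ _)).
suff : cnorm (\sum_(1 <= n < x.+1 | (q %| n)%N) z ^+ w n) <= x%:R / 144 by lra.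
apply: le_trans (ler_norm_sum _ _ _) _; under eq_bigr do rewrite cnorm_expr1//.
rewrite sum_dvdn_eq ?prime_gt0// sumr_const_nat subn1/=.
apply: le_trans (natr_divn_le _ _ _) _.
have q_geR : 144 <= q%:R :> R by rewrite ler_nat.
by rewrite ler_wpM2l// lef_pV2 ?posrE//; lra.
Qed.

End AdditiveFunctions.

(** * The exponential sum over [n + w n] *)

Section ShiftedExponentialSum.
Variables (w : nat -> nat) (R : realType) (z : R[i]) (q : nat).
Hypotheses (w_add : additive_arith w) (w_prime : forall p, prime p -> w p = 1%N).
Hypotheses (q_prime : prime q) (z_prim : q.-primitive_root z).
Implicit Types (d k m n N : nat).

Lemma cnorm_primitive_root : cnorm z = 1.
Proof. exact: cnorm_unity_root (prime_gt0 q_prime) (prim_expr_order z_prim). Qed.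

Definition qfree_twist n : R[i] := z ^+ w n`_(q^'%N).

Lemma cnorm_qfree_twist n : cnorm (qfree_twist n) = 1.
Proof. exact: cnorm_expr1 cnorm_primitive_root. Qed.

Lemma qfree_twist_pfactor k m : ~~ (q %| m)%N -> (0 < m)%N ->
  qfree_twist (q ^ k * m) = z ^+ w m.
Proof.
move=> q_m m_gt0; have qk_gt0 : (0 < q ^ k)%N by rewrite expn_gt0 prime_gt0.
rewrite /qfree_twist partnM// part_p'nat ?pnatNK ?pnatX ?pnat_id// mul1n.
by rewrite part_pnat_id ?p'natE.
Qed.

Lemma qfree_twist_expn k : qfree_twist (q ^ k) = 1.
Proof.
rewrite -[(q ^ k)%N]muln1 qfree_twist_pfactor ?(additive_arith1 w_add)//.
by rewrite dvdn1 gtn_eqF// prime_gt1.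
Qed.

Lemma qfree_twist_coprime n : ~~ (q %| n)%N -> (0 < n)%N -> qfree_twist n = z ^+ w n.
Proof. by move=> q_n n_gt0; have := qfree_twist_pfactor 0 q_n n_gt0; rewrite mul1n. Qed.

Lemma qfree_twist_mult : mult_arith qfree_twist.
Proof.
split=> [|m n m_gt0 n_gt0 co_mn]; first exact: (qfree_twist_expn 0).
rewrite /qfree_twist partnM// w_add ?part_gt0 ?exprD//.
exact: coprime_dvdl (dvdn_part _ _) (coprime_dvdr (dvdn_part _ _) co_mn).
Qed.

Definition qfree_coef d : R := cnorm (mobius_transform qfree_twist d).

Lemma qfree_coef_sparse : sparse_mult (cnorm (z - 1)) qfree_coef.
Proof.
apply: mobius_transform_sparse => [||p p_pr]; first exact: qfree_twist_mult.
  exact: cnorm_qfree_twist.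
have [->|p_neq] := eqVneq p q.
  by rewrite (qfree_twist_expn 1 : qfree_twist q = 1) subrr normr0.
by rewrite qfree_twist_coprime ?w_prime ?prime_gt0// dvdn_prime2// eq_sym.
Qed.

(* A frequency [d] divisible by [q] does not contribute: the transform vanishes at
   powers of [q]. *)
Lemma qfree_twist_sum_le N :
  cnorm (\sum_(1 <= n < N.+1) qfree_twist n * z ^+ n) <= q%:R * summatory qfree_coef N.
Proof.
apply: exp_sum_convolution_le; rewrite ?prime_gt0 ?prim_expr_order//.
  by move=> n; exact: sum_mobius_transform qfree_twist_mult.
move=> d d_gt0 /eqP; rewrite -(prim_order_dvd z_prim) => q_d.
have [m co_qm d_eq] := pfactor_coprime q_prime d_gt0.
have m_gt0 : (0 < m)%N by move: d_gt0; rewrite d_eq muln_gt0 => /andP[].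
have logn_gt0 : (0 < logn q d)%N by rewrite logn_gt0 mem_primes q_prime d_gt0.
have qk_gt0 : (0 < q ^ logn q d)%N by rewrite expn_gt0 prime_gt0.
rewrite d_eq mobius_transformM//; last by rewrite coprimeXr// coprime_sym.
by rewrite mobius_transform_pfactor// !qfree_twist_expn subrr mulr0.
Qed.

Lemma shifted_exp_sum_decomposition N :
  \sum_(1 <= n < N.+1) z ^+ (n + w n) =
  \sum_(1 <= n < N.+1) qfree_twist n * z ^+ n +
  ((z - 1) * \sum_(1 <= m < (N %/ q).+1 | ~~ (q %| m)%N) z ^+ w m +
   \sum_(1 <= n < N.+1 | (q ^ 2 %| n)%N) (z ^+ w n - qfree_twist n) * z ^+ n).
Proof.
have q_gt0 := prime_gt0 q_prime.
have -> : (z - 1) * \sum_(1 <= m < (N %/ q).+1 | ~~ (q %| m)%N) z ^+ w m =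
    \sum_(1 <= n < N.+1 | logn q n == 1%N) (z ^+ w n - qfree_twist n) * z ^+ n.
  rewrite sum_logn_eq// mulr_sumr big_nat_cond [RHS]big_nat_cond.
  apply: eq_bigr => m /andP[/andP[m_gt0 _] q_m]; rewrite qfree_twist_pfactor// expn1.
  rewrite exprM (prim_expr_order z_prim) expr1n mulr1.
  by rewrite w_add ?prime_coprime// (w_prime q_prime) exprD expr1 mulrBl mul1r.
rewrite [X in _ + (X + _)]big_mkcond [X in _ + (_ + X)]big_mkcond -!big_split/=.
apply: eq_big_nat => n /andP[n_gt0 _]; rewrite addnC exprD pfactor_dvdn//.
have [q_n|q_n] := boolP (q %| n)%N; last first.
  by rewrite logn_coprime ?prime_coprime//= qfree_twist_coprime// !addr0.
have : (0 < logn q n)%N by rewrite logn_gt0 mem_primes q_prime n_gt0.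
by case: logn => [|[|k]]//= _; rewrite ?addr0 ?add0r -mulrDl subrKC.
Qed.

Lemma square_multiples_sum_le N :
  cnorm (\sum_(1 <= n < N.+1 | (q ^ 2 %| n)%N) (z ^+ w n - qfree_twist n) * z ^+ n)
    <= 2 * (N%:R / q%:R ^+ 2).
Proof.
apply: le_trans (ler_norm_sum _ _ _) _.
apply: (@le_trans _ _ (\sum_(1 <= n < N.+1 | (q ^ 2 %| n)%N) 2)).
  apply: ler_sum => n _; rewrite cnormM cnorm_expr1 ?cnorm_primitive_root// mulr1.
  apply: le_trans (ler_normB _ _) _.
  by rewrite cnorm_qfree_twist cnorm_expr1// cnorm_primitive_root.
rewrite sum_dvdn_eq ?expn_gt0 ?prime_gt0// sumr_const_nat subn1/= -[leLHS]mulr_natr.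
by rewrite ler_wpM2l// -natrX natr_divn_le.
Qed.

Lemma shifted_exp_sum_ge N :
  cnorm (z - 1) * cnorm (\sum_(1 <= m < (N %/ q).+1 | ~~ (q %| m)%N) z ^+ w m) <=
  cnorm (\sum_(1 <= n < N.+1) z ^+ (n + w n)) + 2 * (N%:R / q%:R ^+ 2)
    + q%:R * summatory qfree_coef N.
Proof.
have /esym/(canRL (addKr _))/(canRL (addrK _)) main_eq := shifted_exp_sum_decomposition N.
rewrite -cnormM main_eq [leRHS]addrAC.
apply: le_trans (ler_normB _ _) _; apply: lerD; last exact: square_multiples_sum_le.
rewrite [- _ + _]addrC; apply: le_trans (ler_normB _ _) _.
by rewrite lerD2l qfree_twist_sum_le.
Qed.

End ShiftedExponentialSum.

Section ExceptionalValues.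

Lemma exists_preimage_seq (T : eqType) (v : T -> T) (s : seq T) : uniq s ->
  exists t, [/\ uniq t, {subset t <= s} & map v t = [seq m <- s | m \in map v s]].
Proof.
case: s => [_|x0 s0]; first by exists [::].
move: (x0 :: s0) => s s_uniq; pose preimage m := nth x0 s (index m (map v s)).
pose t := [seq preimage m | m <- s & m \in map v s].
have map_t : map v t = [seq m <- s | m \in map v s].
  rewrite -map_comp -[RHS]map_id; apply/eq_in_map => m.
  rewrite mem_filter => /andP[m_v _].
  by rewrite /= -(nth_map x0 x0 v) ?nth_index// -(size_map v) index_mem.
exists t; split=> //; first by apply: (@map_uniq _ _ v); rewrite map_t filter_uniq.
move=> x /mapP[m]; rewrite mem_filter => /andP[m_v _] ->.
by rewrite mem_nth// -(size_map v) index_mem.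
Qed.

(* A preimage in [s] is chosen for each [m] in [s] that has one; the [n] left over are
   as many as the [m] that are missed. *)
Lemma norm_sum_range_le (R : numDomainType) (V : normedZmodType R) (T : eqType)
    (v : T -> T) (u : T -> V) (s : seq T) : uniq s -> (forall m, `|u m| <= 1) ->
  `|\sum_(n <- s) u (v n)| <=
    `|\sum_(m <- s) u m| + 2 * (size [seq m <- s | m \notin map v s])%:R.
Proof.
move=> s_uniq u_le1; have [t [t_uniq t_s map_t]] := exists_preimage_seq v s_uniq.
set missed := [seq m <- s | _]; pose rest := [seq n <- s | n \notin t].
have perm_missed : perm_eq s ([seq m <- s | m \in map v s] ++ missed).
  by rewrite perm_sym; exact/permEl/perm_filterC.
have perm_rest : perm_eq s (t ++ rest).
  rewrite -(perm_filterC [in t]) perm_cat2r; apply: uniq_perm => //.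
    by rewrite filter_uniq.
  by move=> n; rewrite mem_filter; apply: andb_idr; exact: t_s.
have size_rest : size rest = size missed.
  apply: (@addnI (size t)); rewrite -size_cat -(perm_size perm_rest).
  by rewrite -(size_map v t) map_t -size_cat -(perm_size perm_missed).
have sum_le_size (r : seq T) (f : T -> T) : `|\sum_(n <- r) u (f n)| <= (size r)%:R.
  by apply: le_trans (ler_norm_sum _ _ _) _; rewrite -sum1_size natr_sum ler_sum.
have -> : \sum_(n <- s) u (v n) =
    \sum_(m <- s) u m - \sum_(m <- missed) u m + \sum_(n <- rest) u (v n).
  rewrite (perm_big _ perm_rest) big_cat/= -(big_map v xpredT u) map_t.
  by rewrite [X in _ = X - _ + _](perm_big _ perm_missed) big_cat/= addrK.
rewrite mulr2n mulrDl mul1r addrA; apply: le_trans (ler_normD _ _) _.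
rewrite lerD//; last by rewrite -size_rest sum_le_size.
by apply: le_trans (ler_normB _ _) _; rewrite lerD2l (sum_le_size _ id).
Qed.

Lemma XiE w N (s := index_iota 1 N.+1) :
  Xi w N = size [seq m <- s | m \notin [seq (n + w n)%N | n <- s]].
Proof.
set missed := [seq m <- s | _]; have missed_uniq : uniq missed.
  by rewrite filter_uniq ?iota_uniq.
rewrite /Xi -(undup_id missed_uniq) -card_fseq; congr (#|` _|).
rewrite -[RHS]set_fsetK; congr fset_set; apply/seteqP; split=> m /=.
  move=> [m_in [_ m_exc]]; rewrite inE mem_filter mem_index_iota ltnS m_in andbT.
  apply/mapP => -[n]; rewrite mem_index_iota => /andP[n_gt0 _] m_eq.
  by apply: m_exc; exists n.
rewrite inE mem_filter mem_index_iota ltnS => /andP[/mapP m_missed m_in]; split=> //.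
have /andP[m_gt0 m_le] := m_in; split=> // -[n n_gt0 m_eq]; apply: m_missed.
exists n => //; rewrite mem_index_iota n_gt0 ltnS (leq_trans _ m_le)//.
by rewrite m_eq leq_addr.
Qed.

Lemma shifted_exp_sum_le_Xi (R : realType) (z : R[i]) w q N :
    (1 < q)%N -> q.-primitive_root z ->
  cnorm (\sum_(1 <= n < N.+1) z ^+ (n + w n)) <= q%:R + 2 * (Xi w N)%:R.
Proof.
move=> q_gt1 z_prim; have q_gt0 := ltnW q_gt1; have zq := prim_expr_order z_prim.
have z_norm1 := cnorm_unity_root q_gt0 zq.
have expr_le1 m : cnorm (z ^+ m) <= 1 by rewrite cnorm_expr1.
rewrite XiE; apply: le_trans (norm_sum_range_le _ (iota_uniq _ _) expr_le1) _.
rewrite lerD2r; apply: cnorm_sum_unity_root_le => //.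
by rewrite -[z]expr1 -(prim_order_dvd z_prim) dvdn1 gtn_eqF.
Qed.

End ExceptionalValues.

(** * Choice of the root of unity *)

Section RootsOfUnity.
Variable R : realType.
Implicit Types (t : R) (q a k : nat).

Lemma sin_MVT t : 0 <= t -> exists2 c, 0 <= c <= t & sin t = cos c * t.
Proof.
move=> t_ge0; have [|c] := @MVT_segment R sin cos 0 t t_ge0 (fun x _ => is_derive_sin x).
  exact/continuous_subspaceT/continuous_sin.
by rewrite in_itv/= sin0 !subr0 => c_in sin_eq; exists c.
Qed.

Lemma sin_le t : 0 <= t -> sin t <= t.
Proof. by move=> t_ge0; have [c _ ->] := sin_MVT t_ge0; rewrite ler_piMl// cos_le1. Qed.

Lemma cos_ge t : 0 <= t -> 1 - t ^+ 2 / 2 <= cos t.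
Proof.
move=> t_ge0; have t2_ge0 : 0 <= t / 2 by rewrite divr_ge0.
have -> : cos t = 1 - 2 * sin (t / 2) ^+ 2.
  rewrite -[t in LHS](divfK (_ : 2 != 0)) ?pnatr_eq0// mulr_natr cos_mulr2n cos2sin2.
  by rewrite mulr2n; ring.
have [c _ sin_eq] := sin_MVT t2_ge0.
have : sin (t / 2) ^+ 2 <= (t / 2) ^+ 2.
  by rewrite sin_eq exprMn ler_piMl ?sqr_ge0// -real_normK ?num_real// expr_le1// cos_max.
by rewrite [(t / 2) ^+ 2]exprMn; lra.
Qed.

Lemma sin_ge_half t : 0 <= t <= 1 -> t / 2 <= sin t.
Proof.
move=> /andP[t_ge0 t_le1]; have [c /andP[c_ge0 c_le] ->] := sin_MVT t_ge0.
rewrite mulrC ler_wpM2r//; have := cos_ge c_ge0.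
have : c ^+ 2 <= 1 by rewrite expr_le1//; lra.
lra.
Qed.

Definition cis t : R[i] := (cos t +i* sin t)%C.

Lemma cis0 : cis 0 = 1.
Proof. by rewrite /cis cos0 sin0. Qed.

Lemma cisD s t : cis (s + t) = cis s * cis t.
Proof. by rewrite /cis cosD sinD [X in (_ +i* X)%C]addrC. Qed.

Lemma cisX t k : cis t ^+ k = cis (t *+ k).
Proof. by elim: k => [|k IHk]; rewrite ?cis0// exprS IHk -cisD mulrS. Qed.

Lemma cis2piMn k : cis (pi *+ 2 *+ k) = 1.
Proof. by rewrite -cisX /cis cos2pi sin2pi expr1n. Qed.

Lemma cnorm_cisB1 t : cnorm (cis (t *+ 2) - 1) = 2 * `|sin t|.
Proof.
have -> : cis (t *+ 2) - 1 = (- (2 * sin t ^+ 2) +i* (2 * (cos t * sin t)))%C.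
  rewrite -[LHS]/((cos (t *+ 2) - 1) +i* (sin (t *+ 2) - 0))%C subr0.
  by rewrite cos_mulr2n sin_mulr2n cos2sin2; congr Complex; rewrite !mulr2n; ring.
rewrite /Num.norm/= (_ : _ + _ = (2 * sin t) ^+ 2) ?sqrtr_sqr ?normrM ?normr_nat//.
transitivity (4 * sin t ^+ 2 * (cos t ^+ 2 + sin t ^+ 2)); first by ring.
by rewrite cos2Dsin2; ring.
Qed.

Lemma exists_primitive_root_near1 q a : prime q -> (0 < a)%N -> (4 * a <= q)%N ->
  exists2 z : R[i], q.-primitive_root z
    & 2 * a%:R / q%:R <= cnorm (z - 1) <= 8 * a%:R / q%:R.
Proof.
move=> q_pr a_gt0 q_ge; have a_gt0R : 0 < a%:R :> R by rewrite ltr0n.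
have q_geR : 4 * a%:R <= q%:R :> R by rewrite -natrM ler_nat.
have q_gt0R : 0 < q%:R :> R by lra.
pose t : R := pi * a%:R / q%:R.
have t_ge : 2 * a%:R / q%:R <= t by rewrite !ler_pM2r ?invr_gt0// pi_ge2.
have t_le : t <= 4 * a%:R / q%:R.
  by rewrite !ler_pM2r ?invr_gt0//; have := pihalf_lt2 R; lra.
have t_gt0 : 0 < t by apply: lt_le_trans t_ge; rewrite divr_gt0 ?mulr_gt0.
have t01 : 0 <= t <= 1 by rewrite ltW//= (le_trans t_le)// ler_pdivrMr// mul1r.
have half_le := sin_ge_half t01; have le_t := sin_le (ltW t_gt0).
have norm_eq : cnorm (cis (t *+ 2) - 1) = 2 * sin t.
  by rewrite cnorm_cisB1 ger0_norm//; lra.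
exists (cis (t *+ 2)); last by rewrite norm_eq; apply/andP; split; lra.
apply: prime_primitive_root => //; last first.
  by apply: contra_eq_neq norm_eq => ->; rewrite subrr normr0 lt_eqF//; lra.
rewrite cisX (_ : t *+ 2 *+ q = pi *+ 2 *+ a) ?cis2piMn//.
rewrite mulrnAC [RHS]mulrnAC; congr (_ *+ 2).
by rewrite -[LHS]mulr_natr -[RHS]mulr_natr divfK ?gt_eqF.
Qed.

End RootsOfUnity.

Section LowerBound.
Variable R : realType.
Implicit Types (A B D K L Y : R) (a e q N : nat) (z : R[i]).

(* With these constants the main term of [shifted_exp_sum_ge] is at least
   [4 N / q ^ 2], while its two error terms add up to at most [3 N / q ^ 2]. *)
Record admissible_root D e N q z : Prop := AdmissibleRoot {
  admissible_prime : prime q;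
  admissible_primitive : q.-primitive_root z;
  admissible_ge : 8 * 144 / q%:R <= cnorm (z - 1);
  admissible_le1 : cnorm (z - 1) <= 1;
  admissible_turan : 72 * 144 * (cnorm (z - 1) ^+ 2 * (3 * recip_primes R N + 1)) <= 1;
  admissible_saving : D <= cnorm (z - 1) ^+ e * ln N%:R;
  admissible_error : D * (q%:R * cnorm (z - 1)) ^+ 4 <= q%:R;
  admissible_large : 2 * q%:R ^+ 3 <= N%:R :> R }.

Section FixedRoot.
Variables (D : R) (e N q : nat) (z : R[i]) (w : nat -> nat).
Hypotheses (z_adm : admissible_root D e N q z) (saving : power_saving D e 4).
Hypotheses (w_add : additive_arith w) (w_prime : forall p, prime p -> w p = 1%N).

Lemma admissible_q_ge : 8 * 144 <= q%:R :> R.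
Proof.
have q_gt0 : 0 < q%:R :> R by rewrite ltr0n prime_gt0// (admissible_prime z_adm).
have := le_trans (admissible_ge z_adm) (admissible_le1 z_adm).
by rewrite ler_pdivrMr// mul1r.
Qed.

Lemma admissible_main_term : 4 * (N%:R / q%:R ^+ 2) <=
  cnorm (z - 1) * cnorm (\sum_(1 <= m < (N %/ q).+1 | ~~ (q %| m)%N) z ^+ w m).
Proof.
have [q_pr z_prim eta_ge _ turan _ _ N_ge] := z_adm; have q_ge := admissible_q_ge.
have q_gt0 : 0 < q%:R :> R by lra.
have quotient_ge : N%:R / (2 * q%:R) <= (N %/ q)%:R :> R.
  apply: le_trans (natr_divn_ge R N (prime_gt0 q_pr)).
  have : 1 <= N%:R / (2 * q%:R) :> R.
    rewrite ler_pdivlMr ?mul1r ?mulr_gt0//; apply: le_trans N_ge.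
    by rewrite ler_pM2l// -[leLHS]expr1 ler_eXn2l//; lra.
  have -> : N%:R / q%:R = 2 * (N%:R / (2 * q%:R)) :> R by field; rewrite gt_eqF.
  lra.
have sum_ge : (N %/ q)%:R / 144 <=
    cnorm (\sum_(1 <= m < (N %/ q).+1 | ~~ (q %| m)%N) z ^+ w m).
  apply: cnorm_sum_expr_additive_coprime_ge => //.
  - exact: cnorm_primitive_root q_pr z_prim.
  - by rewrite -(ler_nat R); lra.
  - apply: le_trans turan; rewrite ler_pM2l// ler_wpM2l ?sqr_ge0//.
    by rewrite lerD2r ler_wpM2l// recip_primes_mono// leq_div.
rewrite [leLHS](_ : _ = 8 * 144 / q%:R * (N%:R / (2 * q%:R) / 144)); last first.
  by field; rewrite gt_eqF.
apply: ler_pM eta_ge (le_trans _ sum_ge); rewrite ?divr_ge0 ?mulr_ge0//.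
by rewrite ler_wpM2r.
Qed.

Lemma admissible_error_term :
  q%:R * summatory (qfree_coef w z q) N <= N%:R / q%:R ^+ 2.
Proof.
have [q_pr z_prim _ eta_le1 _ saving_cond error_le N_ge] := z_adm.
have q_gt0 : 0 < q%:R :> R by have := admissible_q_ge; lra.
have eta_gt0 : 0 < cnorm (z - 1).
  by apply: lt_le_trans (admissible_ge z_adm); rewrite divr_gt0.
have N_gt0 : 0 < N%:R :> R by apply: lt_le_trans N_ge; rewrite mulr_gt0// exprn_gt0.
have sum_le : summatory (qfree_coef w z q) N <= D * cnorm (z - 1) ^+ 4 * N%:R.
  apply: saving => //; last by rewrite -(ltr0n R).
    by rewrite eta_gt0.
  exact: qfree_coef_sparse.
apply: (@le_trans _ _ (D * (q%:R * cnorm (z - 1)) ^+ 4 * (N%:R / q%:R ^+ 3))).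
  apply: le_trans (ler_wpM2l (ltW q_gt0) sum_le) _.
  rewrite [leLHS](_ : _ = D * (q%:R * cnorm (z - 1)) ^+ 4 * (N%:R / q%:R ^+ 3))//.
  by field; rewrite gt_eqF.
apply: le_trans (ler_wpM2r _ error_le) _; first by rewrite divr_ge0// exprn_ge0.
rewrite [leLHS](_ : _ = N%:R / q%:R ^+ 2)//.
by field; rewrite gt_eqF.
Qed.

Lemma admissible_Xi_ge : N%:R / (4 * q%:R ^+ 2) <= (Xi w N)%:R :> R.
Proof.
have [q_pr z_prim _ _ _ _ _ N_ge] := z_adm.
have q_gt0 : 0 < q%:R :> R by have := admissible_q_ge; lra.
have q_le : q%:R <= N%:R / q%:R ^+ 2 / 2 :> R.
  rewrite ler_pdivlMr// ler_pdivlMr ?exprn_gt0//.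
  by rewrite [leLHS](_ : _ = 2 * q%:R ^+ 3)//; ring.
rewrite [leLHS](_ : _ = N%:R / q%:R ^+ 2 / 4); last by field; rewrite gt_eqF.
have := admissible_main_term; have := admissible_error_term.
have := shifted_exp_sum_ge w_add w_prime q_pr z_prim N.
have := shifted_exp_sum_le_Xi w N (prime_gt1 q_pr) z_prim.
lra.
Qed.

End FixedRoot.

Lemma admissible_root_of_bounds D e N q z A : 0 <= D ->
    prime q -> q.-primitive_root z -> 8 * 144 / q%:R <= cnorm (z - 1) <= A / q%:R ->
    A <= q%:R -> 72 * 144 * (A ^+ 2 * (3 * recip_primes R N + 1)) <= q%:R ^+ 2 ->
    D * A ^+ 4 <= q%:R -> D * q%:R ^+ e <= ln N%:R -> 2 * q%:R ^+ 3 <= N%:R :> R ->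
  admissible_root D e N q z.
Proof.
move=> D_ge0 q_pr z_prim /andP[eta_ge eta_le] A_le turan error_le saving_cond N_ge.
have q_gt0 : 0 < q%:R :> R by rewrite ltr0n prime_gt0.
have qeta_le : q%:R * cnorm (z - 1) <= A by rewrite mulrC -ler_pdivlMr.
split=> //.
- by apply: (le_trans eta_le); rewrite ler_pdivrMr// mul1r.
- apply: (@le_trans _ _ (72 * 144 * ((A / q%:R) ^+ 2 * (3 * recip_primes R N + 1)))).
    rewrite ler_pM2l// ler_wpM2r//; last by rewrite lerXn2r ?nnegrE ?(le_trans _ eta_le).
    by rewrite addr_ge0// mulr_ge0// recip_primes_ge0.
  by rewrite expr_div_n [A ^+ 2 / _ * _]mulrAC mulrA ler_pdivrMr ?exprn_gt0// mul1r.
- apply: (@le_trans _ _ (q%:R^-1 ^+ e * ln N%:R)).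
    by rewrite exprVn mulrC ler_pdivlMr ?exprn_gt0.
  rewrite ler_wpM2r ?ln_nat_ge0// lerXn2r ?nnegrE ?invr_ge0//.
  by apply: le_trans eta_ge; rewrite ler_peMl ?invr_ge0//; lra.
- apply: le_trans error_le; rewrite ler_wpM2l// lerXn2r ?nnegrE ?mulr_ge0//.
  by apply: le_trans qeta_le; rewrite mulr_ge0.
Qed.

Lemma lnln_near_ge B : \forall N \near \oo, B <= ln (ln N%:R).
Proof.
exists (Num.truncn (expR (expR B))).+1 => // N /= N_ge.
have expexp_le : expR (expR B) <= N%:R.
  by apply: le_trans (ltW (truncnS_gt _)) _; rewrite ler_nat.
have exp_le : expR B <= ln N%:R.
  by rewrite -[leLHS]expRK ler_ln ?posrE ?expR_gt0// (lt_le_trans _ expexp_le) ?expR_gt0.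
by rewrite -[leLHS]expRK ler_ln ?posrE ?expR_gt0// (lt_le_trans _ exp_le) ?expR_gt0.
Qed.

Lemma expR_lnln N : 0 < ln (ln N%:R) :> R -> expR (ln (ln N%:R)) = ln N%:R :> R.
Proof.
move=> lnln_gt0; rewrite lnK// posrE ltNge; apply/negP => /ln0 lnln0.
by rewrite lnln0 ltxx in lnln_gt0.
Qed.

Lemma exprn_le_expR D K e : 0 <= D -> 0 <= K ->
  exists B, forall L, B <= L -> D * (K * L) ^+ e <= expR L.
Proof.
move=> D_ge0 K_ge0; exists (Num.max 0 (D * K ^+ e * e.+1%:R ^+ e.+1)) => L.
rewrite ge_max => /andP[L_ge0 L_ge]; apply: (@le_trans _ _ ((L / e.+1%:R) ^+ e.+1)).
  rewrite expr_div_n ler_pdivlMr ?exprn_gt0// exprMn [L ^+ e.+1]exprSr.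
  rewrite [leLHS](_ : _ = L ^+ e * (D * K ^+ e * e.+1%:R ^+ e.+1)); last by ring.
  by rewrite ler_wpM2l// exprn_ge0.
have -> : expR L = expR (L / e.+1%:R) ^+ e.+1 by rewrite -expRM_natl mulrC divfK.
rewrite lerXn2r ?nnegrE ?expR_ge0 ?divr_ge0//.
by apply: le_trans (expR_ge1Dx _); rewrite lerDr.
Qed.

Lemma exprn_le_ln_near D K e : 0 <= D -> 0 <= K -> \forall N \near \oo,
  forall q : nat, q%:R ^+ 2 <= K * ln (ln N%:R) -> D * q%:R ^+ e <= ln N%:R.
Proof.
move=> D_ge0 K_ge0; have [B le_expR] := exprn_le_expR e D_ge0 K_ge0.
near=> N; have L_gt0 : 0 < ln (ln N%:R) :> R.
  by apply: (@lt_le_trans _ _ 1) => //; near: N; exact: lnln_near_ge.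
have pow_le : D * (K * ln (ln N%:R)) ^+ e <= ln N%:R.
  by rewrite -[leRHS]expR_lnln// le_expR//; near: N; exact: lnln_near_ge.
move=> q q_sqr_le; apply: le_trans pow_le.
have q_le : q%:R <= K * ln (ln N%:R).
  by apply: le_trans q_sqr_le; rewrite -natrX ler_nat; case: q => // q; rewrite leq_pmulr.
by rewrite ler_wpM2l// lerXn2r ?nnegrE// (le_trans _ q_le).
Unshelve. all: end_near. Qed.

Lemma recip_primes_near_le :
  \forall N \near \oo, 3 * recip_primes R N + 1 <= 28 * ln (ln N%:R).
Proof.
near=> N; have L_ge : 19 <= ln (ln N%:R) :> R by near: N; exact: lnln_near_ge.
have L_gt0 : 0 < ln (ln N%:R) :> R by lra.
have lnN_ge1 : 1 <= ln N%:R :> R.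
  by rewrite -expR_lnln//; have := expR_ge1Dx (ln (ln N%:R) : R); lra.
have N_gt0 : (0 < N)%N.
  by apply: contraTT lnN_ge1; rewrite lt0n negbK => /eqP ->; rewrite ln0// -ltNge.
have ln_le : ln (1 + 2 * ln N%:R) <= 2 + ln (ln N%:R) :> R.
  apply: (@le_trans _ _ (ln (3 * ln N%:R))); first by rewrite ler_ln ?posrE; lra.
  by rewrite lnM ?posrE//; [have := @ln_leB1 R 3 ltac:(lra)|]; lra.
have := recip_primes_le R N_gt0; lra.
Unshelve. all: end_near. Qed.

Lemma exists_prime_sqr Y : 1 <= Y ->
  exists2 q, prime q & Y <= q%:R ^+ 2 <= 16 ^+ 4 * Y.
Proof.
move=> Y_ge1; have Y_ge0 : 0 <= Y by lra.
have /andP[n_le n_gt] := truncn_itv Y_ge0; set n := Num.truncn Y in n_le n_gt.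
have n_gt0 : (0 < n)%N by rewrite truncn_gt0.
have /andP[j_le j_gt] := trunc_log_bounds (isT : 1 < 16)%N n_gt0.
have pow16 i : (4 ^ i * 4 ^ i = 16 ^ i)%N by rewrite -expnMn.
have [q q_pr /andP[q_gt q_le]] := exists_prime_exp4 (ltn0Sn (trunc_log 16 n)).
exists q => //; apply/andP; split.
  apply: le_trans (ltW n_gt) _; rewrite -natrX ler_nat (leq_trans j_gt)//.
  by rewrite -pow16 -mulnn leq_mul// ltnW.
apply: (@le_trans _ _ (16 ^+ 4 * n%:R)); last by rewrite ler_wpM2l ?exprn_ge0.
rewrite -!natrX -natrM ler_nat -mulnn (leq_trans (leq_mul q_le q_le))//.
by rewrite pow16 addSn -addnS expnD mulnC leq_mul.
Qed.

Lemma prime_sqr_near K B : 1 <= K -> 0 <= B -> \forall N \near \oo,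
  exists2 q, prime q &
    B <= q%:R /\ K * ln (ln N%:R) <= q%:R ^+ 2 <= 16 ^+ 4 * K * ln (ln N%:R).
Proof.
move=> K_ge1 B_ge0; near=> N.
have L_ge1 : 1 <= ln (ln N%:R) :> R by near: N; exact: lnln_near_ge.
have B_sqr_le : B ^+ 2 <= ln (ln N%:R) by near: N; exact: lnln_near_ge.
have [|q q_pr /andP[q_ge q_le]] := @exists_prime_sqr (K * ln (ln N%:R)).
  by rewrite mulr_ege1.
exists q => //; rewrite q_ge -mulrA q_le; split=> //.
rewrite -ler_sqr ?nnegrE// (le_trans B_sqr_le)// (le_trans _ q_ge)//.
by rewrite ler_peMl//; lra.
Unshelve. all: end_near. Qed.

Lemma exists_admissible_root D e N q a (A := 8 * a%:R : R) : 0 <= D ->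
    prime q -> (4 * 144 <= a)%N -> A <= q%:R ->
    72 * 144 * (A ^+ 2 * (3 * recip_primes R N + 1)) <= q%:R ^+ 2 ->
    D * A ^+ 4 <= q%:R -> D * q%:R ^+ e <= ln N%:R -> 2 * q%:R ^+ 3 <= N%:R :> R ->
  exists z, admissible_root D e N q z.
Proof.
move=> D_ge0 q_pr a_ge A_le turan error_le saving_cond N_ge.
have a_geR : 4 * 144 <= a%:R :> R by rewrite -natrM ler_nat.
have q_ge : (4 * a <= q)%N by rewrite -(ler_nat R) natrM; move: A_le; rewrite /A; lra.
have a_gt0 : (0 < a)%N by exact: leq_trans a_ge.
have [z z_prim /andP[eta_ge eta_le]] :=
  exists_primitive_root_near1 R q_pr a_gt0 q_ge.
exists z; apply: (@admissible_root_of_bounds D e N q z A) => //.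
by rewrite eta_le andbT (le_trans _ eta_ge)// ler_wpM2r//; lra.
Qed.

Lemma admissible_root_near D e : 0 <= D ->
  exists2 K : R, 0 < K & \forall N \near \oo, exists q (z : R[i]),
    admissible_root D e N q z /\ q%:R ^+ 2 <= K * ln (ln N%:R).
Proof.
move=> D_ge0; have [a a_ge] : exists a, (4 * 144 <= a)%N by exists (4 * 144)%N.
have A_ge1 : 1 <= 8 * a%:R :> R by rewrite -natrM ler1n; lia.
have := @exists_admissible_root D e _ _ a D_ge0 _ a_ge; move: (8 * a%:R : R) A_ge1 => A.
move=> A_ge1 root_of_bounds; pose K0 := 72 * 144 * (A ^+ 2 * 28); pose K := 16 ^+ 4 * K0.
have K0_ge1 : 1 <= K0 by have := exprn_ege1 2 A_ge1; rewrite /K0; lra.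
have K_ge1 : 1 <= K by rewrite mulr_ege1// exprn_ege1//; lra.
exists K; first by lra.
have B_ge0 : 0 <= A + D * A ^+ 4 by rewrite addr_ge0 ?mulr_ge0 ?exprn_ge0//; lra.
near=> N.
have turan_le : 3 * recip_primes R N + 1 <= 28 * ln (ln N%:R).
  by near: N; exact: recip_primes_near_le.
have pow_le q : q%:R ^+ 2 <= K * ln (ln N%:R) -> D * q%:R ^+ e <= ln N%:R.
  by move: q; near: N; apply: exprn_le_ln_near; lra.
have cube_le q : q%:R ^+ 2 <= K * ln (ln N%:R) -> 2 * q%:R ^+ 3 <= ln N%:R :> R.
  by move: q; near: N; apply: exprn_le_ln_near; lra.
have [q q_pr [q_ge /andP[q_sqr_ge q_sqr_le]]] : exists2 q, prime q &
    A + D * A ^+ 4 <= q%:R /\ K0 * ln (ln N%:R) <= q%:R ^+ 2 <= K * ln (ln N%:R).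
  by near: N; exact: prime_sqr_near.
have ln_le : ln N%:R <= N%:R :> R.
  by case: (N) => [|n]; [rewrite ln0|exact/ltW/ln_sublinear].
have DA_ge0 : 0 <= D * A ^+ 4 by rewrite mulr_ge0// exprn_ge0//; lra.
have [||||||z z_adm] := root_of_bounds N q => //; first lra.
- apply: le_trans q_sqr_ge.
  rewrite [leRHS](_ : _ = 72 * 144 * (A ^+ 2 * (28 * ln (ln N%:R)))).
    by rewrite ler_wpM2l// ler_wpM2l// sqr_ge0.
  by rewrite /K0; ring.
- lra.
- exact: pow_le.
- exact: le_trans (cube_le q q_sqr_le) ln_le.
by exists q, z.
Unshelve. all: end_near. Qed.

End LowerBound.

Theorem theorem1 (R : realType) (w : nat -> nat)
    (w_add : additive_arith w)
    (w_prime : forall q : nat, prime q -> w q = 1%N) :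
  exists2 c : R, 0 < c &
    \forall N \near \oo, c * (N%:R / ln (ln N%:R)) <= (Xi w N)%:R.
Proof.
have [D [e [D_ge1 saving]]] := exists_power_saving R 4.
have [|K K_gt0 root_near] := @admissible_root_near R D e; first by lra.
exists (4 * K)^-1; first by rewrite invr_gt0 mulr_gt0.
near=> N; have L_gt0 : 0 < ln (ln N%:R) :> R.
  by apply: (@lt_le_trans _ _ 1) => //; near: N; exact: lnln_near_ge.
have [q [z [z_adm q_le]]] : exists q (z : R[i]),
    admissible_root D e N q z /\ q%:R ^+ 2 <= K * ln (ln N%:R) by near: N.
have q_gt0 : 0 < q%:R :> R by rewrite ltr0n prime_gt0// (admissible_prime z_adm).
apply: le_trans (admissible_Xi_ge z_adm saving w_add w_prime).
rewrite mulrCA -invfM ler_wpM2l// lef_pV2 ?posrE ?mulr_gt0 ?exprn_gt0//.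
by rewrite -mulrA ler_pM2l.
Unshelve. all: end_near.
Qed.
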